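(* Consider, for a sequence $n\to\infty$ with $p=p_n>n$ and $\log(p)/n=o(1)$, the linear model $Y=\mathbf{X}\beta^0+\varepsilon$ with Gaussian error $\varepsilon\sim\mathcal{N}_n(0,\sigma_\varepsilon^2I)$ independent of the random $n\times p$ design $\mathbf{X}$, where $\sigma_\varepsilon^2=\mathcal{O}(1)$. Assume that the rows of $\mathbf{X}$ are i.i.d. realizations from a Gaussian distribution whose $p$-dimensional inner product matrix $\Sigma$ has strictly positive smallest eigenvalue $\Lambda_{\min}^2$ satisfying $1/\Lambda_{\min}^2=\mathcal{O}(1)$, and that $\max_j\Sigma_{j,j}=\mathcal{O}(1)$. Assume the sparsity conditions $s_0=o(\sqrt n/\log(p))$ and $\max_j s_j=o(n/\log(p))$. Then, for a suitable choice of the regularization parameters $\lambda\asymp\sqrt{\log(p)/n}$ for the lasso $\hat\beta$ and $\lambda_j\asymp\sqrt{\log(p)/n}$ uniformly in $j$ for the nodewise lasso $\hat\Theta=\hat\Theta_{\mathrm{Lasso}}$, the estimator $\hat b_{\mathrm{Lasso}}=\hat\beta+\hat\Theta\mathbf{X}^T(Y-\mathbf{X}\hat\beta)/n$ satisfies $$\sqrt n(\hat b_{\mathrm{Lasso}}-\beta^0)=W+\Delta,$$ $$W|\mathbf{X}\sim\mathcal{N}_p(0,\sigma_\varepsilon^2\hat\Omega),\qquad\hat\Omega:=\hat\Theta\hat\Sigma\hat\Theta^T,$$ $$\|\Delta\|_\infty=o_{\mathbb{P}}(1).$$ Furthermore, $\|\hat\Omega-\Sigma^{-1}\|_\infty=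o_{\mathbb{P}}(1)$.
   Context: All quantities ($p$, $\mathbf{X}$, $\beta^0$, $\Sigma$, $\sigma_\varepsilon^2$, $s_0$, $s_j$, ...) may depend on $n$. The inner product matrix is $\Sigma=\mathbb{E}[\mathbf{X}^T\mathbf{X}/n]$; $\hat\Sigma=\mathbf{X}^T\mathbf{X}/n$; $\Theta:=\Sigma^{-1}$. $s_0=|\{j:\beta^0_j\ne0\}|$ and $s_j:=|\{k\ne j:\Theta_{j,k}\neq0\}|$. For a matrix $A$, $\|A\|_\infty=\max_{j,k}|A_{j,k}|$. ''Suitable choice of $\lambda\asymp\sqrt{\log(p)/n}$ and $\lambda_j\asymp\sqrt{\log(p)/n}$ uniformly in $j$'' means that there exist such parameters, bounded above and below by fixed positive constants (not depending on $n$ or $j$) times $\sqrt{\log(p)/n}$, for which the conclusion holds. Notation: $X_j$ is the $j$th column of $\mathbf{X}$ and $\mathbf{X}_{-j}$ is $\mathbf{X}$ without column $j$. Lasso: $\hat\beta:=\arg\min_{\beta\in\mathbb{R}^p}\left(\|Y-\mathbf{X}\beta\|_2^2/n+2\lambda\|\beta\|_1\right)$. Nodewise lasso: $\hat\gamma_j:=\arg\min_{\gamma\in\mathbb{R}^{p-1}}\left(\|X_j-\mathbf{X}_{-j}\gamma\|_2^2/n+2\lambda_j\|\gamma\|_1\right)$ with components $\hat\gamma_{j,k}$, $k\ne j$; $\hat\tau_j^2:=\|X_j-\mathbf{X}_{-j}\hat\gamma_j\|_2^2/n+\lambda_j\|\hat\gamma_j\|_1$; $\hat C$ is the $p\times p$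 matrix with $\hat C_{j,j}=1$, $\hat C_{j,k}=-\hat\gamma_{j,k}$ for $k\neq j$; $\hat T^2=\mathrm{diag}(\hat\tau_1^2,\dots,\hat\tau_p^2)$; $\hat\Theta_{\mathrm{Lasso}}:=\hat T^{-2}\hat C$. *)

(* Defs.v *)
From HB Require Import structures.
From mathcomp Require Import all_boot all_order all_algebra.
From mathcomp Require Import all_classical all_reals all_analysis.
Set Implicit Arguments. Unset Strict Implicit. Unset Printing Implicit Defensive.
Import Order.TTheory GRing.Theory Num.Theory.
Import numFieldNormedType.Exports.
Local Open Scope classical_set_scope.
Local Open Scope ring_scope.

(* Matrices with their Borel sigma-algebra; the carrier is 'M[R]_(m, n). *)
Notation borelM R m n := (g_sigma_algebraType (@open 'M[R]_(m, n))).

Section gaussian.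
Context {R : realType}.

(* N(m, v) with v the variance.  normal_prob takes the standard deviation and
   is not a Dirac mass when that is 0, so the degenerate case is separate. *)
Definition normal_law (m v : R) (A : set R) : \bar R :=
  if v == 0 then \d_m A else normal_prob m (Num.sqrt v) A.

(* mu = N_p(m, S), S possibly singular: S is a covariance matrix and every
   linear functional a^T x is univariate normal under mu. *)
Definition mvnormal p (mu : set (borelM R p 1) -> \bar R)
    (m : 'cV[R]_p) (S : 'M[R]_p) : Prop :=
  [/\ S^T = S,
      forall a : 'cV[R]_p, 0 <= (a^T *m S *m a) 0 0 &
      forall (a : 'cV[R]_p) (A : set R), measurable A ->
        mu [set x : borelM R p 1 | A ((a^T *m (x : 'cV[R]_p)) 0 0)] =
        normal_law ((a^T *m m) 0 0) ((a^T *m S *m a) 0 0) A].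

End gaussian.

Section probability.
Context {R : realType} {d : measure_display} {T : measurableType d}.
Variable P : probability T R.

Definition independent2 d1 d2 (T1 : measurableType d1) (T2 : measurableType d2)
    (X : T -> T1) (Y : T -> T2) : Prop :=
  forall A B, measurable A -> measurable B ->
    P (X @^-1` A `&` Y @^-1` B) = (P (X @^-1` A) * P (Y @^-1` B))%E.

Definition mutually_independent (I : finType) d1 (T1 : measurableType d1)
    (Z : I -> T -> T1) : Prop :=
  forall (J : {set I}) (A : I -> set T1), (forall i, measurable (A i)) ->
    P (\bigcap_(i in [set i | i \in J]) (Z i @^-1` A i)) =
    (\prod_(i in J) P (Z i @^-1` A i))%E.

(* W | X ~ N_p(0, S(X)): some regular conditional distribution k of W given X
   consists of these normal laws. *)
Definition cond_centered_normal d1 (T1 : measurableType d1) p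
    (W : {RV P >-> borelM R p 1}) (X : {RV P >-> T1}) (S : T1 -> 'M[R]_p) : Prop :=
  exists k : R.-pker T1 ~> borelM R p 1,
    (forall A B, measurable A -> measurable B ->
       P (X @^-1` A `&` W @^-1` B) = (\int[distribution P X]_(x in A) k x B)%E)
    /\ (forall x, mvnormal (k x) 0 (S x)).

Definition row_vec n p (X : T -> borelM R n p) (i : 'I_n) : T -> borelM R p 1 :=
  fun w => (row i (X w : 'M[R]_(n, p)))^T.

(* The Gaussian law of the rows is not assumed to be centered. *)
Definition iid_gaussian_rows n p (X : {RV P >-> borelM R n p}) : Prop :=
  mutually_independent (row_vec X) /\
  exists (m : 'cV[R]_p) (G : 'M[R]_p),
    forall i, mvnormal (pushforward P (row_vec X i)) m G.

End probability.

(* Z_n = o_P(1) in the max norm `| | of matrices; the n-th variable lives on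
   its own probability space. *)
Definition oP1 {R : realType} {d : nat -> measure_display}
    {T : forall n, measurableType (d n)} (P : forall n, probability (T n) R)
    (r c : nat -> nat) (Z : forall n, T n -> 'M[R]_(r n, c n)) : Prop :=
  forall e : R, 0 < e ->
    (fun n => P n [set w | e < `|Z n w| ]) @ \oo --> (0 : \bar R).

Section lasso.
Context {R : realType}.

Definition sqnorm2 n (v : 'cV[R]_n) : R := \sum_i v i 0 ^+ 2.
Definition norm1 n (v : 'cV[R]_n) : R := \sum_i `|v i 0|.

Definition gram n p (X : 'M[R]_(n, p)) : 'M[R]_p := n%:R^-1 *: (X^T *m X).

Definition inner_product_matrix d (T : measurableType d) (P : probability T R)
    n p (X : T -> 'M[R]_(n, p)) : 'M[R]_p :=
  \matrix_(j, k) fine ('E_P[fun w => gram (X w) j k])%E.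

Definition smallest_eigenvalue p (A : 'M[R]_p) (l : R) : Prop :=
  eigenvalue A l /\ forall l', eigenvalue A l' -> l <= l'.

Definition sparsity p (b : 'cV[R]_p) : nat := #|[set j | b j 0 != 0]|.
Definition row_sparsity p (Theta : 'M[R]_p) (j : 'I_p) : nat :=
  #|[set k | (k != j) && (Theta j k != 0)]|.

Definition lasso_objective n p (lam : R) (Y : 'cV[R]_n) (X : 'M[R]_(n, p))
    (b : 'cV[R]_p) : R :=
  sqnorm2 (Y - X *m b) / n%:R + 2 * lam * norm1 b.

(* The argmin need not be unique. *)
Definition is_lasso n p (lam : R) (Y : 'cV[R]_n) (X : 'M[R]_(n, p))
    (b : 'cV[R]_p) : Prop :=
  forall b', lasso_objective lam Y X b <= lasso_objective lam Y X b'.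

(* col' j X is X without its j-th column; a coefficient vector g of the j-th
   nodewise regression is indexed by 'I_p.-1 through unlift j. *)
Definition is_nodewise_lasso n p (lam : R) (X : 'M[R]_(n, p)) (j : 'I_p)
    (g : 'cV[R]_p.-1) : Prop :=
  is_lasso lam (col j X) (col' j X) g.

Definition nodewise_tau2 n p (lam : R) (X : 'M[R]_(n, p)) (j : 'I_p)
    (g : 'cV[R]_p.-1) : R :=
  sqnorm2 (col j X - col' j X *m g) / n%:R + lam * norm1 g.

Definition nodewise_C p (g : 'I_p -> 'cV[R]_p.-1) : 'M[R]_p :=
  \matrix_(j, k) if unlift j k is Some k' then - g j k' 0 else 1.

Definition Theta_lasso n p (lam : 'I_p -> R) (X : 'M[R]_(n, p))
    (g : 'I_p -> 'cV[R]_p.-1) : 'M[R]_p :=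
  diag_mx (\row_j (nodewise_tau2 (lam j) X j (g j))^-1) *m nodewise_C g.

Definition desparsified n p (Theta : 'M[R]_p) (Y : 'cV[R]_n) (X : 'M[R]_(n, p))
    (b : 'cV[R]_p) : 'cV[R]_p :=
  b + n%:R^-1 *: (Theta *m X^T *m (Y - X *m b)).

Definition Omega_hat n p (Theta : 'M[R]_p) (X : 'M[R]_(n, p)) : 'M[R]_p :=
  Theta *m gram X *m Theta^T.

End lasso.

(* Main.v *)
(* Write r = sqrt (log p / n) and S^ = X^T X / n.  For a Gaussian row x, E exp (t (u^T x)^2)
   is explicit, so S^ deviates from Sigma in the direction u by a relative amount delta
   with probability at most 2 exp (- n delta^2 / 16).  A union bound over O(p^2) vectors
   gives |S^ Theta - I| = O(r) and |Theta S^ Theta - Theta| = O(r) entrywise.  As the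
   sparsity of Theta is only o(n / log p), entrywise closeness of S^ to Sigma is too weak
   for the nodewise lassos.  Instead, the lower deviation bound is applied to all (2p)^k
   sums of k = c n / log p signed unit vectors, and Maurey's empirical method extends it
   to v^T S^ v >= v^T Sigma v / 2 - C r^2 |v|_1^2 for every v, which is a restricted
   eigenvalue condition on the cones of s-sparse problems with s r^2 small.
   The lasso oracle inequalities follow.  The optimality conditions of the nodewise lassos
   say that |Theta^ S^ - I| = O(r) entrywise, so that the remainder
   Delta = - sqrt n (Theta^ S^ - I) (beta^ - beta0) is O(s0 log p / sqrt n), and the
   oracle inequalities make Theta^ - Theta small in the seminorm of S^, uniformly in the
   rows, which yields the claim on Omega^.  Conditionally on X the vector
   W = Theta^ X^T eps / sqrt n is linear in the Gaussian eps. *)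
Require Import Defs.
From HB Require Import structures.
From mathcomp Require Import all_boot all_order all_algebra.
From mathcomp Require Import all_classical all_reals all_analysis.
From mathcomp Require Import measurable_realfun.
From mathcomp Require Import ring lra.
Set Implicit Arguments. Unset Strict Implicit. Unset Printing Implicit Defensive.
Import Order.TTheory GRing.Theory Num.Theory.
Import numFieldNormedType.Exports.
Local Open Scope classical_set_scope.
Local Open Scope ring_scope.

(** * Quadratic forms and Maurey averaging *)

Section quadratic_forms.
Context {R : realType}.

(** The obstacle is that [max s_j] may come close to [n / log p]. The l1 error of a nodewise lasso
    is then only known to be of order [s_j r], which may diverge, so nothing may rest on it; its
    squared prediction error, of order [s_j r^2], does vanish. This is why Omega^ is expanded as a
    bilinear form of S^ in the rows of Theta^: Cauchy-Schwarz then asks for the S^-seminorm of the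
    row errors alone. The l1 error enters only for beta^, paired with an entrywise bound that comes
    from optimality and involves no sparsity. The nodewise regressions become deterministic
    problems: with [c0 = Theta_j / Theta_jj] the identity [X_j = X_{-j} gamma_j + X c0] is a linear
    model, and the correlation of its noise [X c0] with the other columns consists of off-diagonal
    entries of S^ Theta, divided by [Theta_jj]. The rows may have a mean, so Sigma is a matrix of
    second moments and [(u^T x)^2] is noncentral chi-square; its exponential moments are bounded
    through the second moment alone. The size of [k] balances two demands: [k log (2p)] has to stay
    below the exponent [n / 64] of a single deviation, and the l1 penalty of order [1 / k] has to be
    O(r^2). *)

Definition bform p (M : 'M[R]_p) (u v : 'cV[R]_p) : R := (u^T *m M *m v) 0 0.
Definition qform p (M : 'M[R]_p) (u : 'cV[R]_p) : R := bform M u u.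

Lemma bformDl p (M : 'M[R]_p) u v w : bform M (u + v) w = bform M u w + bform M v w.
Proof. by rewrite /bform linearD /= !mulmxDl mxE. Qed.
Lemma bformDr p (M : 'M[R]_p) u v w : bform M u (v + w) = bform M u v + bform M u w.
Proof. by rewrite /bform !mulmxDr mxE. Qed.
Lemma bformZl p (M : 'M[R]_p) a u v : bform M (a *: u) v = a * bform M u v.
Proof. by rewrite /bform linearZ /= -!scalemxAl mxE. Qed.
Lemma bformZr p (M : 'M[R]_p) a u v : bform M u (a *: v) = a * bform M u v.
Proof. by rewrite /bform -!scalemxAr mxE. Qed.
Lemma bformNl p (M : 'M[R]_p) u v : bform M (- u) v = - bform M u v.
Proof. by rewrite -scaleN1r bformZl mulN1r. Qed.
Lemma bformNr p (M : 'M[R]_p) u v : bform M u (- v) = - bform M u v.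
Proof. by rewrite -scaleN1r bformZr mulN1r. Qed.
Lemma bform0l p (M : 'M[R]_p) v : bform M 0 v = 0.
Proof. by rewrite -(scale0r 0) bformZl mul0r. Qed.
Lemma bform0r p (M : 'M[R]_p) v : bform M v 0 = 0.
Proof. by rewrite -(scale0r 0) bformZr mul0r. Qed.
Lemma bform_suml p (M : 'M[R]_p) I (r : seq I) (P : pred I) F v :
  bform M (\sum_(i <- r | P i) F i) v = \sum_(i <- r | P i) bform M (F i) v.
Proof. by elim/big_rec2: _ => [|i a b _ <-]; rewrite ?bform0l// bformDl. Qed.
Lemma bform_sumr p (M : 'M[R]_p) I (r : seq I) (P : pred I) F v :
  bform M v (\sum_(i <- r | P i) F i) = \sum_(i <- r | P i) bform M v (F i).
Proof. by elim/big_rec2: _ => [|i a b _ <-]; rewrite ?bform0r// bformDr. Qed.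
Lemma bformC p (M : 'M[R]_p) u v : M^T = M -> bform M u v = bform M v u.
Proof.
move=> sM; rewrite /bform.
have -> : v^T *m M *m u = (u^T *m M *m v)^T by rewrite !trmx_mul trmxK sM mulmxA.
by rewrite [RHS]mxE.
Qed.
Lemma bformDM p (M N : 'M[R]_p) u v : bform (M + N) u v = bform M u v + bform N u v.
Proof. by rewrite /bform mulmxDr mulmxDl mxE. Qed.
Lemma bformZM p a (M : 'M[R]_p) u v : bform (a *: M) u v = a * bform M u v.
Proof. by rewrite /bform -scalemxAr -scalemxAl mxE. Qed.
Lemma bformNM p (M : 'M[R]_p) u v : bform (- M) u v = - bform M u v.
Proof. by rewrite -scaleN1r bformZM mulN1r. Qed.
Lemma qformD p (M : 'M[R]_p) u v :
  qform M (u + v) = qform M u + bform M u v + bform M v u + qform M v.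
Proof. by rewrite /qform !bformDl !bformDr; ring. Qed.
Lemma qformZ p (M : 'M[R]_p) a u : qform M (a *: u) = a ^+ 2 * qform M u.
Proof. by rewrite /qform bformZl bformZr mulrA. Qed.

Lemma bform_delta p (M : 'M[R]_p) j k : bform M (delta_mx j 0) (delta_mx k 0) = M j k.
Proof. by rewrite /bform trmx_delta -rowE -colE !mxE. Qed.
Lemma bform_deltal p (M : 'M[R]_p) j u : bform M (delta_mx j 0) u = (M *m u) j 0.
Proof. by rewrite /bform trmx_delta -mulmxA -rowE mxE. Qed.

Lemma bform_polar p (M : 'M[R]_p) u v : M^T = M ->
  bform M u v = (qform M (u + v) - qform M (u - v)) / 4.
Proof.
move=> sM; rewrite !qformD /qform !(bformNl, bformNr) (bformC v u sM); lra.
Qed.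

Definition psd p (M : 'M[R]_p) := M^T = M /\ forall u, 0 <= qform M u.

Lemma bform_CauchySchwarz p (M : 'M[R]_p) u v : psd M ->
  bform M u v ^+ 2 <= qform M u * qform M v.
Proof.
move=> [sM pM].
have key t : 0 <= qform M u + t * 2 * bform M u v + t ^+ 2 * qform M v.
  by have := pM (u + t *: v); rewrite qformD bformZl bformZr (bformC v u sM) qformZ; lra.
have := pM v; rewrite le_eqVlt => /orP[/eqP v0|v0]; last first.
  have := key (- bform M u v / qform M v).
  have -> : qform M u + - bform M u v / qform M v * 2 * bform M u v +
     (- bform M u v / qform M v) ^+ 2 * qform M v =
     (qform M u * qform M v - bform M u v ^+ 2) / qform M v.
    by field; rewrite gt_eqF.
  by rewrite pmulr_lge0 ?invr_gt0// subr_ge0.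
rewrite -v0 mulr0.
have [->|b0] := eqVneq (bform M u v) 0; first by rewrite expr0n.
(* Here [key] is affine in [t], and this [t] gives it the value -1. *)
have := key (- (qform M u + 1) / (2 * bform M u v)).
rewrite -v0 mulr0 addr0.
have -> : - (qform M u + 1) / (2 * bform M u v) * 2 * bform M u v = - (qform M u + 1).
  by field.
by lra.
Qed.

(* Maurey's empirical method: the conclusion is the expectation of [qform M] at
   [a] plus a sum of [k] independent atoms drawn with the weights [w]. *)
Lemma maurey_average p (I : finType) (M : 'M[R]_p) (w : I -> R) (x : I -> 'cV[R]_p)
    (v := \sum_i w i *: x i) (k : nat) (a : 'cV[R]_p) :
  (forall i, 0 <= w i) -> \sum_i w i = 1 ->
  (forall s : seq I, size s = k -> 0 <= qform M (a + \sum_(i <- s) x i)) ->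
  0 <= qform M (a + k%:R *: v) + k%:R * (\sum_i w i * qform M (x i) - qform M v).
Proof.
move=> w0 w1; elim: k a => [|k IH] a H.
  by have := H [::] erefl; rewrite big_nil scale0r mul0r !addr0.
have {}IH i : 0 <= qform M (a + k%:R *: v + x i) +
    k%:R * (\sum_i w i * qform M (x i) - qform M v).
  rewrite -addrA [_ *: v + _]addrC addrA; apply: IH => s sk.
  by have := H (i :: s); rewrite /= sk big_cons addrA => /(_ erefl).
have : 0 <= \sum_i w i * (qform M (a + k%:R *: v + x i) +
    k%:R * (\sum_i w i * qform M (x i) - qform M v)).
  by apply: sumr_ge0 => i _; exact: mulr_ge0.
set b := a + _ *: v; set D := _ - qform M v.
(* Averaging over one atom gives the value of the form at the mean plus [D], the variance of a
   single atom with respect to [M]. *)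
suff -> : \sum_i w i * (qform M (b + x i) + k%:R * D) =
   qform M (b + v) + D + k%:R * D.
  rewrite -addrA -[k.+1%:R]natr1 scalerDl scale1r [a + _]addrA -/b.
  by rewrite mulrDl mul1r [_ * D + D]addrC.
have hl : bform M v b = \sum_i w i * bform M (x i) b.
  by rewrite bform_suml; apply: eq_bigr => i _; rewrite bformZl.
have hr : bform M b v = \sum_i w i * bform M b (x i).
  by rewrite bform_sumr; apply: eq_bigr => i _; rewrite bformZr.
under eq_bigr do rewrite mulrDr qformD !mulrDr.
rewrite !big_split/= -!mulr_suml w1 !mul1r qformD hl hr /D; ring.
Qed.

End quadratic_forms.

(** * The lasso oracle inequality *)

Section lasso_lemmas.
Context {R : realType}.

Lemma sqnorm2_ge0 n (v : 'cV[R]_n) : 0 <= sqnorm2 v.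
Proof. by apply: sumr_ge0 => i _; exact: sqr_ge0. Qed.

Lemma norm1_ge0 n (v : 'cV[R]_n) : 0 <= norm1 v.
Proof. by apply: sumr_ge0. Qed.

Lemma sqnorm2E n (v : 'cV[R]_n) : sqnorm2 v = (v^T *m v) 0 0.
Proof. by rewrite mxE; apply: eq_bigr => i _; rewrite !mxE expr2. Qed.

Lemma qform1 n (v : 'cV[R]_n) : qform 1%:M v = sqnorm2 v.
Proof. by rewrite /qform /bform mulmx1 sqnorm2E. Qed.

Lemma psd1 n : psd (1%:M : 'M[R]_n).
Proof. by split=> [|u]; [exact: trmx1|rewrite qform1; exact: sqnorm2_ge0]. Qed.

Lemma bform_gram n p (X : 'M[R]_(n, p)) u v :
  bform (gram X) u v = n%:R^-1 * ((X *m u)^T *m (X *m v)) 0 0.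
Proof. by rewrite /gram bformZM /bform trmx_mul !mulmxA. Qed.

Lemma qform_gram n p (X : 'M[R]_(n, p)) v :
  qform (gram X) v = sqnorm2 (X *m v) / n%:R.
Proof. by rewrite /qform bform_gram -sqnorm2E mulrC. Qed.

Lemma psd_gram n p (X : 'M[R]_(n, p)) : psd (gram X).
Proof.
split=> [|u]; first by rewrite /gram linearZ/= trmx_mul trmxK.
by rewrite qform_gram mulr_ge0 ?sqnorm2_ge0 ?invr_ge0.
Qed.

(** Minus half the gradient of the squared loss, so that optimality reads: [lasso_grad] is [lam]
    times a subgradient of the l1 norm at [b]. *)
Definition lasso_grad n p (Y : 'cV[R]_n) (X : 'M[R]_(n, p)) b : 'cV[R]_p :=
  n%:R^-1 *: (X^T *m (Y - X *m b)).

Lemma dot_lasso_grad n p (Y : 'cV[R]_n) (X : 'M[R]_(n, p)) b (h : 'cV[R]_p) :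
  \sum_k h k 0 * lasso_grad Y X b k 0 =
  n%:R^-1 * ((X *m h)^T *m (Y - X *m b)) 0 0.
Proof.
rewrite trmx_mul -mulmxA [in RHS]mxE mulr_sumr; apply: eq_bigr => k _.
by rewrite [lasso_grad _ _ _ _ _]mxE [h^T _ _]mxE mulrCA.
Qed.

(** The loss is quadratic, so the expansion is exact. It is used around the minimizer for the
    optimality conditions and around the true vector for the oracle inequality. *)
Lemma lasso_objectiveD n p lam (Y : 'cV[R]_n) (X : 'M[R]_(n, p)) b h :
  lasso_objective lam Y X (b + h) = lasso_objective lam Y X b + qform (gram X) h
    - 2 * (\sum_k h k 0 * lasso_grad Y X b k 0) + 2 * lam * (norm1 (b + h) - norm1 b).
Proof.
rewrite /lasso_objective mulmxDr opprD addrA dot_lasso_grad qform_gram.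
move: (Y - X *m b) (X *m h) => r z.
have -> : sqnorm2 (r - z) = sqnorm2 r - 2 * (z^T *m r) 0 0 + sqnorm2 z.
  rewrite !sqnorm2E [(r - z)^T]linearB/= mulmxBl !mulmxBr.
  have -> : r^T *m z = (z^T *m r)^T by rewrite trmx_mul trmxK.
  have D (A B : 'M[R]_1) : (A - B) 0 0 = A 0 0 - B 0 0 by rewrite !mxE.
  have T (A : 'M[R]_1) : A^T 0 0 = A 0 0 by rewrite mxE.
  by rewrite !D T; ring.
by ring.
Qed.

Lemma is_lasso_increment n p lam (Y : 'cV[R]_n) (X : 'M[R]_(n, p)) b :
  is_lasso lam Y X b -> forall h,
  0 <= qform (gram X) h - 2 * (\sum_k h k 0 * lasso_grad Y X b k 0)
    + 2 * lam * (norm1 (b + h) - norm1 b).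
Proof. by move=> H h; have := H (b + h); rewrite lasso_objectiveD; lra. Qed.

(** Dividing by [t] and letting [t] tend to 0 would do; the explicit point [t = c / (a + c)] yields
    a negative value at once if [c] is positive. *)
Lemma le0_first_order (a c : R) :
  0 <= a -> (forall t, 0 < t -> t <= 1 -> 0 <= t ^+ 2 * a - 2 * t * c) -> c <= 0.
Proof.
move=> a0 H; rewrite leNgt; apply/negP => c0.
have d0 : 0 < c / (a + c) by rewrite divr_gt0//; lra.
have d1 : c / (a + c) <= 1 by rewrite ler_pdivrMr; lra.
have := H _ d0 d1.
have -> : (c / (a + c)) ^+ 2 * a - 2 * (c / (a + c)) * c =
   - (c ^+ 2 * (a + 2 * c) / (a + c) ^+ 2) by field; lra.
rewrite oppr_ge0 leNgt => /negP; apply.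
by rewrite divr_gt0 ?mulr_gt0 ?exprn_gt0//; lra.
Qed.

Lemma norm1Z n a (v : 'cV[R]_n) : norm1 (a *: v) = `|a| * norm1 v.
Proof. by rewrite /norm1 mulr_sumr; apply: eq_bigr => i _; rewrite mxE normrM. Qed.

Lemma ler_norm1D n (u v : 'cV[R]_n) : norm1 (u + v) <= norm1 u + norm1 v.
Proof.
by rewrite /norm1 -big_split/=; apply: ler_sum => i _; rewrite mxE; exact: ler_normD.
Qed.

Lemma norm1_delta n (k : 'I_n) : norm1 (delta_mx k 0 : 'cV[R]_n) = 1.
Proof.
rewrite /norm1 (bigD1 k)//= big1 => [|i ik]; rewrite mxE eqxx andbT ?(negPf ik) ?normr0//.
by rewrite normr1 addr0.
Qed.

(** Moving one coordinate by [t * s], with [s] a sign, raises the l1 norm by at most [t], so the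
    first-order gain in the loss cannot exceed [lam]. *)
Lemma lasso_grad_le n p lam (Y : 'cV[R]_n) (X : 'M[R]_(n, p)) b : 0 <= lam ->
  is_lasso lam Y X b -> forall k, `|lasso_grad Y X b k 0| <= lam.
Proof.
move=> lam0 /is_lasso_increment H k; set g := lasso_grad _ _ _ in H *.
suff S (s : R) : `|s| = 1 -> s * g k 0 <= lam.
  rewrite ler_norml; apply/andP; split.
    by have := S (-1); rewrite normrN1 => /(_ erefl); lra.
  by have := S 1; rewrite normr1 => /(_ erefl); lra.
move=> s1; rewrite -subr_le0.
apply: (@le0_first_order (qform (gram X) (delta_mx k 0))).
  by case: (psd_gram X) => _; exact.
move=> t t0 _; have := H ((t * s) *: delta_mx k 0).
rewrite qformZ (bigD1 k)//= big1 => [|i ik]; last first.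
  by rewrite !mxE (negPf ik) mulr0 mul0r.
rewrite !mxE !eqxx mulr1 addr0.
have := ler_norm1D b ((t * s) *: delta_mx k 0).
rewrite norm1Z norm1_delta normrM s1 !mulr1 (gtr0_norm t0).
rewrite exprMn -[s ^+ 2]real_normK ?num_real// s1 expr1n mulr1.
set N := norm1 (b + _); set q := qform _ _.
move=> N1 N2.
have : lam * (N - norm1 b) <= lam * t by apply: ler_wpM2l; lra.
by lra.
Qed.

(** Along the ray through [b] the l1 norm is linear near [b], so the first-order condition holds in
    both directions and becomes an equality. *)
Lemma dot_lasso_grad_self n p lam (Y : 'cV[R]_n) (X : 'M[R]_(n, p)) b :
  is_lasso lam Y X b -> \sum_k b k 0 * lasso_grad Y X b k 0 = lam * norm1 b.
Proof.
move=> /is_lasso_increment H; set g := lasso_grad _ _ _ in H *.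
set q := qform (gram X) b; have q0 : 0 <= q by case: (psd_gram X) => _; exact.
have K t : -1 <= t -> 0 <= t ^+ 2 * q - 2 * t * (\sum_k b k 0 * g k 0 - lam * norm1 b).
  move=> t1; have := H (t *: b); rewrite qformZ.
  have -> : b + t *: b = (1 + t) *: b by rewrite scalerDl scale1r.
  rewrite norm1Z.
  rewrite ger0_norm; last by lra.
  under eq_bigr do rewrite mxE -mulrA.
  by rewrite -mulr_sumr -/q; lra.
apply/eqP; rewrite eq_le -subr_le0 -[X in _ && X]subr_le0; apply/andP; split.
  by apply: (le0_first_order q0) => t t0 _; apply: K; lra.
apply: (le0_first_order q0) => t t0 t1; have := K (- t).
by rewrite sqrrN lerN2 => /(_ t1); lra.
Qed.

Lemma sum_norm_sqr_le n (v : 'cV[R]_n) (S : {set 'I_n}) :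
  (\sum_(i in S) `|v i 0|) ^+ 2 <= #|S|%:R * sqnorm2 v.
Proof.
pose u : 'cV[R]_n := \col_i (i \in S)%:R; pose a : 'cV[R]_n := \col_i `|v i 0|.
have := bform_CauchySchwarz u a (psd1 n).
rewrite !qform1 /bform mulmx1 mxE.
have -> : \sum_j u^T 0 j * a j 0 = \sum_(i in S) `|v i 0|.
  rewrite [RHS]big_mkcond; apply: eq_bigr => i _.
  by rewrite !mxE; case: (i \in S); rewrite ?mul1r ?mul0r.
have -> : sqnorm2 u = #|S|%:R.
  rewrite /sqnorm2 -sum1_card natr_sum [RHS]big_mkcond; apply: eq_bigr => i _.
  by rewrite mxE; case: (i \in S); rewrite ?expr1n ?expr0n.
suff -> : sqnorm2 a = sqnorm2 v by [].
by apply: eq_bigr => i _; rewrite mxE real_normK ?num_real.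
Qed.

Lemma sparsityE n (b : 'cV[R]_n) : sparsity b = #|[set j | b j 0 != 0]%SET|.
Proof. by apply: eq_card => j; rewrite inE; apply/asboolP/idP. Qed.

(** With [A] and [B] the l1 masses of the error on and off the support, the error lies in the cone
    [B <= 3 * A], where [norm1 v ^+ 2 <= 16 * s * sqnorm2 v]. The l1 penalty in the restricted
    eigenvalue bound therefore uses up at most half of [kap]. *)
Lemma lasso_oracle n p lam kap rho (X : 'M[R]_(n, p)) (b0 b : 'cV[R]_p) e :
  0 < lam -> 0 < kap -> 0 <= rho -> is_lasso lam (X *m b0 + e) X b ->
  (forall k, `|(n%:R^-1 *: (X^T *m e)) k 0| <= lam / 2) ->
  (forall v, kap * sqnorm2 v - rho * norm1 v ^+ 2 <= qform (gram X) v) ->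
  16 * rho * (sparsity b0)%:R <= kap / 2 ->
  qform (gram X) (b - b0) <= 32 * lam ^+ 2 * (sparsity b0)%:R / kap /\
  norm1 (b - b0) <= 8 * lam * (sparsity b0)%:R / kap.
Proof.
move=> lam0 kap0 rho0 lb noise re sp; set s : R := (sparsity b0)%:R in sp *.
set v := b - b0; have bE : b = b0 + v by rewrite /v addrC subrK.
clearbody v; set Q := qform (gram X) v.
pose S := [set j | b0 j 0 != 0]%SET.
pose A := \sum_(i in S) `|v i 0|; pose B := \sum_(i in ~: S) `|v i 0|.
have A0 : 0 <= A by apply: sumr_ge0.
have B0 : 0 <= B by apply: sumr_ge0.
have Q0 : 0 <= Q by case: (psd_gram X) => _; exact.
have N : norm1 v = A + B.
  rewrite /norm1 (bigID (mem S))/=; congr (_ + _).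
  by apply: eq_bigl => i; rewrite !inE.
have basic : Q <= 3 * lam * A - lam * B.
  have := lb b0; rewrite bE lasso_objectiveD -/Q.
  have -> : lasso_grad (X *m b0 + e) X b0 = n%:R^-1 *: (X^T *m e).
    by rewrite /lasso_grad addrAC subrr add0r.
  set z := _ *: _ in noise *.
  have zv : \sum_k v k 0 * z k 0 <= lam / 2 * (A + B).
    rewrite -N /norm1 mulr_sumr; apply: ler_sum => k _.
    apply: (le_trans (ler_norm _)); rewrite normrM mulrC.
    exact: ler_wpM2r.
  have nb : B - A <= norm1 (b0 + v) - norm1 b0.
    rewrite /norm1 -sumrB [leRHS](bigID (mem S))/= addrC.
    rewrite -sumrN; apply: lerD; last first.
      apply: ler_sum => i _; rewrite mxE.
      have := ler_normB (b0 i 0 + v i 0) (v i 0); rewrite addrK; lra.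
    rewrite /B (eq_bigl (fun i => i \notin S)); last by move=> i; rewrite !inE.
    apply: ler_sum => i; rewrite inE negbK => /eqP i0.
    by rewrite mxE i0 add0r normr0 subr0.
  have := ler_wpM2l (ltW lam0) nb; lra.
have cone : B <= 3 * A.
  rewrite -(ler_pM2l lam0); lra.
have CS : A ^+ 2 <= s * sqnorm2 v by rewrite /s sparsityE; exact: sum_norm_sqr_le.
have N2 : norm1 v ^+ 2 <= 16 * (s * sqnorm2 v).
  have : norm1 v ^+ 2 <= (4 * A) ^+ 2.
    by rewrite N ler_pXn2r ?nnegrE//; lra.
  by rewrite exprMn; lra.
have QV : kap / 2 * sqnorm2 v <= Q.
  have := re v; rewrite -/Q.
  have := ler_wpM2l rho0 N2.
  have := ler_wpM2r (sqnorm2_ge0 v) sp.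
  by lra.
(* Chosen such that [4 * lam * A <= sqrt (D * Q)]. Together with [Q + lam * norm1 v <= 4 * lam * A]
   this gives [Q <= D], and through [sqrt (D * Q) <= Q + D / 4] the l1 bound. *)
pose D := 32 * lam ^+ 2 * s / kap.
have s0 : 0 <= s by rewrite /s ler0n.
have D0 : 0 <= D by rewrite /D !mulr_ge0// ?invr_ge0; lra.
have AD : (4 * lam * A) ^+ 2 <= D * Q.
  have -> : (4 * lam * A) ^+ 2 = 16 * lam ^+ 2 * A ^+ 2 by ring.
  have l2 : 0 <= 16 * lam ^+ 2 by rewrite mulr_ge0// sqr_ge0.
  apply: (le_trans (ler_wpM2l l2 CS)).
  have := ler_wpM2l (mulr_ge0 l2 s0) QV.
  have -> : D * Q = 2 / kap * (16 * lam ^+ 2 * s * Q) by rewrite /D; field; lra.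
  move=> H; have := ler_wpM2l (_ : 0 <= 2 / kap) H.
  have -> : 2 / kap * (16 * lam ^+ 2 * s * (kap / 2 * sqnorm2 v)) =
    16 * lam ^+ 2 * (s * sqnorm2 v) by field; lra.
  by apply; rewrite divr_ge0; lra.
have lA0 : 0 <= lam * A by rewrite mulr_ge0// ltW.
have lB0 : 0 <= lam * B by rewrite mulr_ge0// ltW.
have lN0 : 0 <= lam * norm1 v by rewrite mulr_ge0 ?norm1_ge0// ltW.
have QA : Q + lam * norm1 v <= 4 * lam * A by rewrite N; lra.
split.
  change (Q <= D); rewrite leNgt; apply/negP => DQ.
  have : Q ^+ 2 <= D * Q.
    apply: le_trans AD; rewrite ler_pXn2r ?nnegrE//; lra.
  by rewrite expr2 ler_pM2r; lra.
suff H : lam * norm1 v <= D / 4.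
  rewrite -(ler_pM2l lam0); apply: (le_trans H).
  rewrite le_eqVlt; apply/orP; left; apply/eqP; rewrite /D; field; lra.
have : 4 * lam * A <= Q + D / 4.
  rewrite leNgt; apply/negP => H.
  have : (Q + D / 4) ^+ 2 < (4 * lam * A) ^+ 2.
    by rewrite ltr_pXn2r ?nnegrE//; lra.
  have : 0 <= (Q - D / 4) ^+ 2 by exact: sqr_ge0.
  have -> : (Q - D / 4) ^+ 2 = (Q + D / 4) ^+ 2 - D * Q by field.
  by lra.
by lra.
Qed.

End lasso_lemmas.

(** * Restricted eigenvalues *)

Section eigen.
Context {R : realType}.

(** In terms of row vectors, to fit [rV_compact] and [EVT_min_rV]. *)
Lemma continuous_qform_tr n (M : 'M[R]_n) :
  continuous (fun x : 'rV[R]_n => qform M x^T).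
Proof.
have -> : (fun x : 'rV[R]_n => qform M x^T) =
    (fun x => \sum_j \sum_i x 0 i * M i j * x 0 j).
  apply/funext => x; rewrite /qform /bform trmxK mxE; apply: eq_bigr => j _.
  by rewrite !mxE mulr_suml.
have cc i j : continuous (fun x : 'rV[R]_n => x 0 i * M i j * x 0 j).
  move=> x; have c1 k : {for x, continuous (fun y : 'rV[R]_n => y 0 k)}.
    exact: coord_continuous.
  exact: (continuousM (continuousM (c1 i) (@cst_continuous _ _ (M i j) x)) (c1 j)).
apply: continuous_big => [|j _]; first exact: add_continuous.
by apply: continuous_big => [|i _]; [exact: add_continuous|exact: cc].
Qed.

Lemma qform_eq0_kernel n (M : 'M[R]_n) u : psd M -> qform M u = 0 -> M *m u = 0.
Proof.
move=> pM u0; apply/colP => j; rewrite -bform_deltal [RHS]mxE.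
have := bform_CauchySchwarz (delta_mx j 0) u pM; rewrite u0 mulr0.
by move=> H; apply/eqP; rewrite -sqrf_eq0 eq_le H sqr_ge0.
Qed.

(* A minimizer of the Rayleigh quotient on the unit sphere is an eigenvector. *)
Lemma smallest_eigenvalue_le n (M : 'M[R]_n) l u : M^T = M ->
  smallest_eigenvalue M l -> l * sqnorm2 u <= qform M u.
Proof.
move=> sM [_ lmin].
have [->|u0] := eqVneq u 0.
  by rewrite /qform bform0l -qform1 /qform bform0l mulr0.
have sq_gt0 (v : 'cV[R]_n) : v != 0 -> 0 < sqnorm2 v.
  move=> v0; rewrite lt_neqAle sqnorm2_ge0 andbT eq_sym; apply: contra v0 => /eqP v0.
  by have := qform_eq0_kernel (psd1 n) (etrans (qform1 v) v0); rewrite mul1mx => ->.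
pose f (x : 'rV[R]_n) := qform M x^T.
pose g (x : 'rV[R]_n) := qform 1%:M x^T.
pose A := g @^-1` [set 1].
have normalize (v : 'cV[R]_n) : v != 0 -> A ((Num.sqrt (sqnorm2 v))^-1 *: v^T).
  move=> v0; rewrite /A /g /= linearZ/= trmxK qformZ qform1 exprVn sqr_sqrtr ?sqnorm2_ge0//.
  by rewrite mulVf// gt_eqF// sq_gt0.
have cA : compact A.
  have Acl : closed A.
    by apply: closed_comp => [x _|]; [exact: continuous_qform_tr|exact: closed_eq].
  have Bco : compact [set v : 'rV[R]_n | forall i, `[(- 1), 1]%classic (v 0 i)].
    by apply: (@rV_compact R n (fun=> `[(- 1), 1]%classic)) => _; exact: segment_compact.
  apply: subclosed_compact Acl Bco _ => x; rewrite /A /g /= qform1 => x1 i.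
  rewrite in_itv/= -ler_norml -(@ler_pXn2r _ 2)// ?nnegrE// expr1n -x1 /sqnorm2.
  by rewrite real_normK ?num_real// (bigD1 i)//= mxE lerDl sumr_ge0// => j _; exact: sqr_ge0.
have A0 : A !=set0 by exists ((Num.sqrt (sqnorm2 u))^-1 *: u^T); exact: normalize.
have [c /[!inE] Ac cmin] : exists2 c, c \in A & forall t, t \in A -> f c <= f t.
  apply: EVT_min_rV => //; apply: continuous_subspaceT; exact: continuous_qform_tr.
have key (v : 'cV[R]_n) : f c * sqnorm2 v <= qform M v.
  have [->|v0] := eqVneq v 0.
    by rewrite /qform bform0l -qform1 /qform bform0l mulr0.
  have := cmin _ (mem_set (normalize _ v0)).
  rewrite {2}/f linearZ/= trmxK qformZ exprVn sqr_sqrtr ?sqnorm2_ge0//.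
  by rewrite mulrC ler_pdivlMr// sq_gt0.
apply: le_trans (key u); apply: ler_wpM2r; first exact: sqnorm2_ge0.
apply: lmin; apply/eigenvalueP; exists c; last first.
  apply/eqP => c0; move: Ac; rewrite /A /g/= c0 trmx0 /qform bform0l => /eqP.
  by rewrite eq_sym oner_eq0.
(* Shifted by its minimal Rayleigh quotient, [M] stays positive semidefinite and its form vanishes
   at [c], so [c] lies in the kernel. *)
have pN : psd (M - (f c)%:M).
  split=> [|v]; first by rewrite linearB/= sM tr_scalar_mx.
  rewrite /qform bformDM bformNM -scalemx1 bformZM -!/(qform _ _) qform1 subr_ge0.
  exact: key.
have := qform_eq0_kernel pN (_ : qform _ c^T = 0).
rewrite {1}/qform bformDM bformNM -scalemx1 bformZM -!/(qform _ _).
rewrite [X in _ * X](_ : _ = 1) ?mulr1 ?subrr// => /(_ erefl)/(congr1 trmx).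
rewrite trmx_mul trmxK linearB/= sM linearZ/= trmx1 mulmxBr -scalemxAr mulmx1 trmx0.
by move/eqP; rewrite subr_eq0 => /eqP.
Qed.

Definition signed_atom p (a : bool * 'I_p) : 'cV[R]_p := (-1) ^+ a.1 *: delta_mx a.2 0.

Lemma qform_signed_atom p (M : 'M[R]_p) a : qform M (signed_atom a) = M a.2 a.2.
Proof. by rewrite qformZ sqrr_sign mul1r /qform bform_delta. Qed.

(* Every vector is a multiple of a convex combination of signed atoms, so a lower
   bound on sums of [k] atoms transfers to all vectors up to an l1 penalty. *)
Lemma restricted_eigenvalue p (S Sh : 'M[R]_p) K k : (1 < k)%N -> psd S ->
  (forall j, Sh j j <= K) ->
  (forall s : seq (bool * 'I_p), size s = k ->
     qform S (\sum_(a <- s) signed_atom a) / 2 <= qform Sh (\sum_(a <- s) signed_atom a)) ->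
  forall v, qform S v / 2 - K / (k%:R - 1) * norm1 v ^+ 2 <= qform Sh v.
Proof.
move=> k1 [sS pS] ShK H v.
have [v0|v0] := eqVneq (norm1 v) 0.
  suff -> : v = 0.
    rewrite /qform !bform0l /norm1 big1 ?expr0n ?mulr0 ?mul0r ?subr0// => i _.
    by rewrite mxE normr0.
  apply/colP => j; rewrite mxE; apply/eqP; rewrite -normr_eq0 eq_le normr_ge0 andbT -v0.
  by rewrite /norm1 (bigD1 j)//= lerDl sumr_ge0.
have N0 : 0 < norm1 v by rewrite lt_neqAle eq_sym v0 norm1_ge0.
set N := norm1 v in v0 N0 *.
pose M := Sh - 2^-1 *: S.
have qM u : qform M u = qform Sh u - qform S u / 2.
  by rewrite /qform /M bformDM bformNM bformZM mulrC.
(* Each coordinate puts all its weight on the atom that carries its sign. *)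
pose w (a : bool * 'I_p) := if a.1 == (v a.2 0 < 0) then `|v a.2 0| / N else 0.
have wE (V : lmodType R) (F : bool * 'I_p -> V) :
    \sum_a w a *: F a = \sum_j (`|v j 0| / N) *: F (v j 0 < 0, j).
  rewrite (eq_bigr (fun a => w (a.1, a.2) *: F (a.1, a.2))); last by case.
  rewrite -(pair_bigA _ (fun b j => w (b, j) *: F (b, j)))/= exchange_big/=.
  apply: eq_bigr => j _; rewrite (bigD1 (v j 0 < 0))//= big1 ?addr0.
    by rewrite /w /= eqxx.
  by move=> b /negPf bj; rewrite /w /= bj scale0r.
have w0 a : 0 <= w a by rewrite /w; case: ifP => // _; rewrite divr_ge0// ltW.
have wv : \sum_a w a *: signed_atom a = N^-1 *: v.
  rewrite wE; apply/colP => i; rewrite summxE (bigD1 i)//= big1 ?addr0.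
    rewrite !mxE !eqxx mulr1 /=; have [vi|vi] := ltrP (v i 0) 0.
      by rewrite expr1 ltr0_norm// mulrN1 mulrC mulrN opprK.
    by rewrite expr0 mulr1 ger0_norm// mulrC.
  by move=> j ji; rewrite !mxE eq_sym (negPf ji) !mulr0.
have w1 : \sum_a w a = 1.
  have := wE R^o (fun=> 1); rewrite (eq_bigr w) => [->|a _]; last exact: mulr1.
  rewrite (eq_bigr (fun j => `|v j 0| / N)) => [|j _]; last exact: mulr1.
  by rewrite -mulr_suml divff.
have wD : \sum_a w a * qform M (signed_atom a) <= K.
  rewrite -[leRHS]mul1r -w1 mulr_suml; apply: ler_sum => a _; apply: ler_wpM2l => //.
  rewrite qM !qform_signed_atom; have := ShK a.2; have := pS (delta_mx a.2 0).
  by rewrite /qform bform_delta; lra.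
have := @maurey_average R p _ M w (@signed_atom p) k 0 w0 w1.
rewrite wv add0r scalerA !qformZ => Hm.
have {Hm} : 0 <= (k%:R / N) ^+ 2 * qform M v +
   k%:R * (\sum_i w i * qform M (signed_atom i) - N^-1 ^+ 2 * qform M v).
  by apply: Hm => s sk; rewrite add0r qM subr_ge0; exact: H.
set D := \sum_i _ in wD *.
have kk : 1 < k%:R :> R by rewrite ltr1n.
have k1' : k%:R - 1 != 0 :> R by rewrite subr_eq0 gt_eqF.
(* Sampling leaves the factor [k * (k - 1)] on the form at the mean and [k] on the atoms; their
   ratio is the source of the penalty [K / (k - 1)]. *)
have -> : (k%:R / N) ^+ 2 * qform M v + k%:R * (D - N^-1 ^+ 2 * qform M v) =
   k%:R * (k%:R - 1) / N ^+ 2 * (qform M v + D / (k%:R - 1) * N ^+ 2).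
  by field; rewrite v0 k1'.
rewrite pmulr_rge0; last by rewrite divr_gt0 ?exprn_gt0// mulr_gt0//; lra.
have : D / (k%:R - 1) * N ^+ 2 <= K / (k%:R - 1) * N ^+ 2.
  by rewrite ler_pM2r ?exprn_gt0// ler_pM2r// invr_gt0; lra.
by rewrite qM; lra.
Qed.

End eigen.

(** * Nodewise regression *)

Section nodewise_algebra.
Context {R : realType}.

Definition embed p (j : 'I_p) (g : 'cV[R]_p.-1) : 'cV[R]_p :=
  \col_k (if unlift j k is Some k' then g k' 0 else 0).

Lemma embed_eq p (j : 'I_p) (g : 'cV[R]_p.-1) : embed j g j 0 = 0.
Proof. by rewrite mxE unlift_none. Qed.

Lemma embed_lift p (j : 'I_p) (g : 'cV[R]_p.-1) k : embed j g (lift j k) 0 = g k 0.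
Proof. by rewrite mxE liftK. Qed.

Lemma embedB p (j : 'I_p) (g h : 'cV[R]_p.-1) : embed j (g - h) = embed j g - embed j h.
Proof. by apply/colP => k; rewrite !mxE; case: unlift => [i|]; rewrite ?mxE ?subr0. Qed.

Lemma mulmx_embed n p (X : 'M[R]_(n, p)) j g : X *m embed j g = col' j X *m g.
Proof.
apply/colP => i; rewrite !mxE (bigD1_ord j)//= embed_eq mulr0 add0r.
by apply: eq_bigr => k _; rewrite embed_lift mxE.
Qed.

Lemma sqnorm2_embed p (j : 'I_p) (g : 'cV[R]_p.-1) : sqnorm2 (embed j g) = sqnorm2 g.
Proof.
rewrite /sqnorm2 (bigD1_ord j)//= embed_eq expr0n add0r.
by apply: eq_bigr => k _; rewrite embed_lift.
Qed.

Lemma norm1_embed p (j : 'I_p) (g : 'cV[R]_p.-1) : norm1 (embed j g) = norm1 g.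
Proof.
rewrite /norm1 (bigD1_ord j)//= embed_eq normr0 add0r.
by apply: eq_bigr => k _; rewrite embed_lift.
Qed.

Lemma qform_gram_embed n p (X : 'M[R]_(n, p)) j g :
  qform (gram (col' j X)) g = qform (gram X) (embed j g).
Proof. by rewrite !qform_gram mulmx_embed. Qed.

Lemma gram_mulmx n p (X : 'M[R]_(n, p)) (u : 'cV[R]_p) k :
  (gram X *m u) k 0 = n%:R^-1 * (X^T *m (X *m u)) k 0.
Proof. by rewrite /gram -scalemxAl mxE mulmxA. Qed.

(** Row [j] of C^ as a column vector; [X] maps it to the residual of the nodewise regression of
    column [j]. *)
Definition nodewise_row p (j : 'I_p) (g : 'cV[R]_p.-1) : 'cV[R]_p :=
  delta_mx j 0 - embed j g.

Lemma nodewise_CE p (g : 'I_p -> 'cV[R]_p.-1) j k :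
  nodewise_C g j k = nodewise_row j (g j) k 0.
Proof.
rewrite !mxE eqxx andbT; case: unliftP => [i ->|->]; last by rewrite eqxx subr0.
by rewrite eq_sym (negPf (neq_lift _ _)) add0r.
Qed.

Lemma mulmx_nodewise_row n p (X : 'M[R]_(n, p)) j g :
  X *m nodewise_row j g = col j X - col' j X *m g.
Proof. by rewrite mulmxBr mulmx_embed -colE. Qed.

Lemma gram_nodewise_row_lift n p (X : 'M[R]_(n, p)) j g k :
  (gram X *m nodewise_row j g) (lift j k) 0 = lasso_grad (col j X) (col' j X) g k 0.
Proof.
rewrite gram_mulmx mulmx_nodewise_row /lasso_grad [RHS]mxE; congr (_ * _).
by rewrite !mxE; apply: eq_bigr => i _; rewrite !mxE.
Qed.

(** By optimality the penalty term equals the correlation of [g] with the residual, which completes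
    the squared residual norm to the correlation of column [j] with its residual. This makes the
    diagonal of Theta^ S^ exactly 1. *)
Lemma nodewise_tau2E n p lam (X : 'M[R]_(n, p)) j g :
  is_nodewise_lasso lam X j g ->
  nodewise_tau2 lam X j g = (gram X *m nodewise_row j g) j 0.
Proof.
move=> H; rewrite /nodewise_tau2 -(dot_lasso_grad_self H).
rewrite -mulmx_nodewise_row -qform_gram -bform_deltal /qform.
rewrite [X in bform _ X _]/nodewise_row bformDl bformNl addrAC -addrA.
rewrite [X in _ + X](_ : _ = 0) ?addr0//.
apply/eqP; rewrite subr_eq0; apply/eqP.
rewrite /bform -mulmxA [RHS]mxE (bigD1_ord j)//= mxE embed_eq mul0r add0r.
by apply: eq_bigr => k _; rewrite -gram_nodewise_row_lift; congr (_ * _); rewrite mxE embed_lift.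
Qed.

Lemma Theta_lassoE n p (lam : 'I_p -> R) (X : 'M[R]_(n, p)) g j :
  row j (Theta_lasso lam X g) =
  (nodewise_tau2 (lam j) X j (g j))^-1 *: (nodewise_row j (g j))^T.
Proof.
apply/rowP => k; rewrite [LHS]mxE /Theta_lasso mul_diag_mx [LHS]mxE nodewise_CE.
by rewrite [RHS]mxE; congr (_ * _); rewrite ?[RHS]mxE// mxE.
Qed.

End nodewise_algebra.

(** * Deterministic bounds for the nodewise lassos on the good event *)

Section nodewise_bounds.
Context {R : realType} (n p : nat) (X : 'M[R]_(n, p)) (S Th : 'M[R]_p).
Context (lam : 'I_p -> R) (g : 'I_p -> 'cV[R]_p.-1).
Context (K l om rho s0 la : R).
Let Sh := gram X.
Let th j := col j Th.
Context (sS : S^T = S) (STh : S *m Th = 1%:M).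
Context (l0 : 0 < l) (Sl : forall u, l * sqnorm2 u <= qform S u).
Context (SK : forall j, S j j <= K) (rho0 : 0 <= rho).
Context (H1 : forall j k, `|(Sh *m Th) k j - (k == j)%:R| <= om).
Context (H2 : forall j k, `|bform Sh (th j) (th k) - Th j k| <= om).
Context (H3 : forall j, Sh j j <= 2 * K).
Context (H4 : forall v, l / 2 * sqnorm2 v - rho * norm1 v ^+ 2 <= qform Sh v).
Context (la0 : 0 < la) (laE : 2 * K * om <= la) (lamE : forall j, lam j = la).
Context (Hg : forall j, is_nodewise_lasso (lam j) X j (g j)).
Context (Hs : forall j, (row_sparsity Th j)%:R <= s0).
Context (rs : 16 * rho * s0 <= l / 4).

(** [q2] is the oracle bound on the squared prediction error at [kap = l / 2], and [psi] the error
    of tau^2 that results from it. *)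
Let q2 := 64 * la ^+ 2 * s0 / l.
Let psi := K * om + Num.sqrt (2 * K * q2).

Let psdS : psd S.
Proof. by split=> // u; apply: le_trans (Sl u); rewrite mulr_ge0 ?sqnorm2_ge0// ltW. Qed.

Lemma precision_sym : Th^T = Th.
Proof.
have TS : Th *m S = 1%:M by exact: mulmx1C.
rewrite -[LHS](mulmx1) -STh mulmxA.
by rewrite -[S in _ *m S *m _]sS -trmx_mul STh trmx1 mul1mx.
Qed.

Lemma bformS_th j u : bform S u (th j) = u j 0.
Proof.
by rewrite /bform -mulmxA /th colE [S *m _]mulmxA STh mul1mx -colE !mxE.
Qed.

(** Since [S *m th j] is the unit vector at [j], Cauchy-Schwarz gives [1 <= S j j * Th j j], while
    [l * Th j j ^+ 2 <= qform S (th j) = Th j j] gives the other side. *)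
Lemma precision_diag_bounds j : l <= (Th j j)^-1 <= K /\ 0 < Th j j.
Proof.
have E : qform S (th j) = Th j j by rewrite /qform bformS_th mxE.
have CS : 1 <= S j j * Th j j.
  have := bform_CauchySchwarz (delta_mx j 0) (th j) psdS.
  by rewrite bformS_th mxE !eqxx/= expr1n E /qform bform_delta.
have T0 : 0 < Th j j.
  rewrite lt_neqAle -{2}E (proj2 psdS) andbT; apply/eqP => T0.
  by move: CS; rewrite -T0 mulr0 ler10.
split => //; apply/andP; split.
  rewrite -[leRHS]mul1r ler_pdivlMr//.
  have : l * Th j j ^+ 2 <= Th j j.
    rewrite -[leRHS]E; apply: le_trans (Sl (th j)); rewrite ler_pM2l//.
    by rewrite /sqnorm2 (bigD1 j)//= mxE lerDl sumr_ge0// => i _; exact: sqr_ge0.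
  by rewrite expr2 mulrA ger_pMl.
by rewrite -[leLHS]mul1r ler_pdivrMr//; apply: le_trans CS _; rewrite ler_pM2r.
Qed.

(** Population versions: [gam j] holds the coefficients of the regression of variable [j] on the
    others, [c0 j] those of its residual, and [(Th j j)^-1] is the second moment of that
    residual. *)
Let c0 j : 'cV[R]_p := (Th j j)^-1 *: th j.
Let gam j : 'cV[R]_p.-1 := \col_k (- (Th j j)^-1 * Th (lift j k) j).
Let c j : 'cV[R]_p := nodewise_row j (g j).
Let t2 j := nodewise_tau2 (lam j) X j (g j).

Lemma c0E j : c0 j = nodewise_row j (gam j).
Proof.
have [_ T0] := precision_diag_bounds j.
apply/colP => k; rewrite !mxE eqxx andbT; case: unliftP => [i ->|->].
  by rewrite eq_sym (negPf (neq_lift _ _)) !mxE add0r mulNr opprK.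
by rewrite eqxx subr0 mulVf// gt_eqF.
Qed.

Lemma sparsity_gam j : (sparsity (gam j))%:R <= s0.
Proof.
apply: le_trans (Hs j); rewrite ler_nat sparsityE.
have -> : row_sparsity Th j = #|[set k | (k != j) && (Th j k != 0)]%SET|.
  by apply: eq_card => k; rewrite inE; apply/asboolP/idP.
rewrite -(card_imset _ (@lift_inj _ j)); apply/subset_leq_card/fintype.subsetP => _ /imsetP[k + ->].
rewrite !inE mxE => H; rewrite eq_sym neq_lift/= -precision_sym mxE.
by apply: contra_neq H => ->; rewrite mulr0.
Qed.

Lemma sub_nodewise_rows j : c j - c0 j = - embed j (g j - gam j).
Proof. by rewrite c0E /c /nodewise_row embedB !opprB [LHS]addrC addrA subrK. Qed.

(** The lasso oracle inequality for the model with coefficients [gam j] and noise [X *m c0 j]. The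
    noise correlations are off-diagonal entries of [Sh *m Th] divided by [Th j j], hence at most
    [K * om <= la / 2]. *)
Lemma nodewise_oracle j : qform Sh (c j - c0 j) <= q2.
Proof.
have [/andP[Tl TK] T0] := precision_diag_bounds j.
have Y : col j X = col' j X *m gam j + X *m c0 j.
  by rewrite c0E mulmx_nodewise_row addrC subrK.
have L : is_lasso la (col' j X *m gam j + X *m c0 j) (col' j X) (g j).
  by rewrite -Y -(lamE j); exact: Hg.
rewrite sub_nodewise_rows /qform bformNl bformNr opprK -/(qform _ _) /Sh -qform_gram_embed.
have sg := sparsity_gam j; have s00 : 0 <= s0 by apply: le_trans sg.
have l2 : 0 < l / 2 by rewrite divr_gt0.
have [| | |Q _] := lasso_oracle la0 l2 rho0 L.
- move=> k; have -> : (n%:R^-1 *: ((col' j X)^T *m (X *m c0 j))) k 0 =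
     (Th j j)^-1 * (Sh *m Th) (lift j k) j.
    rewrite [LHS]mxE.
    have -> : ((col' j X)^T *m (X *m c0 j)) k 0 = (X^T *m (X *m c0 j)) (lift j k) 0.
      by rewrite !mxE; apply: eq_bigr => i _; rewrite !mxE.
    rewrite -gram_mulmx /c0 -scalemxAr mxE; congr (_ * _).
    by rewrite /th !mxE; apply: eq_bigr => i _; rewrite !mxE.
  rewrite normrM gtr0_norm ?invr_gt0//.
  have := H1 j (lift j k); rewrite eq_sym (negPf (neq_lift _ _)) subr0 => h.
  have : (Th j j)^-1 * `|(Sh *m Th) (lift j k) j| <= K * om.
    by apply: ler_pM => //; rewrite invr_ge0 ltW.
  by move=> h2; apply: (le_trans h2); have := laE; lra.
- move=> v; rewrite qform_gram_embed -(sqnorm2_embed j v) -(norm1_embed j v); exact: H4.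
- rewrite -mulrA; apply: le_trans (_ : 16 * (rho * s0) <= _).
    by rewrite ler_pM2l// ler_wpM2l.
  by have := rs; lra.
apply: (le_trans Q); rewrite /q2.
have -> : 32 * la ^+ 2 * (sparsity (gam j))%:R / (l / 2) =
  64 * la ^+ 2 / l * (sparsity (gam j))%:R by field; rewrite gt_eqF.
rewrite [leRHS]mulrAC; apply: ler_wpM2l => //.
by rewrite divr_ge0 ?mulr_ge0 ?sqr_ge0// ltW.
Qed.

(** By [nodewise_tau2E] tau^2 is linear in the row [c j]. The part [c0 j] is covered by [H1], and
    the difference by Cauchy-Schwarz for the form of [Sh]. *)
Lemma nodewise_tau2_close j : `|t2 j - (Th j j)^-1| <= psi.
Proof.
have [/andP[Tl TK] T0] := precision_diag_bounds j.
rewrite /t2 (nodewise_tau2E (Hg j)) -/(c j) -/Sh -bform_deltal.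
have -> : c j = c0 j + (c j - c0 j) by rewrite addrC subrK.
rewrite bformDr addrAC; apply: (le_trans (ler_normD _ _)); apply: lerD.
  rewrite bformZr bform_deltal.
  have -> : (Sh *m th j) j 0 = (Sh *m Th) j j.
    by rewrite /th !mxE; apply: eq_bigr => i _; rewrite !mxE.
  rewrite -[X in _ - X]mulr1 -mulrBr normrM gtr0_norm ?invr_gt0//.
  by apply: ler_pM => //; [rewrite invr_ge0 ltW|have := H1 j j; rewrite eqxx].
rewrite -sqrtr_sqr ler_wsqrtr//.
have := bform_CauchySchwarz (delta_mx j 0) (c j - c0 j) (psd_gram X).
move/le_trans; apply; apply: ler_pM; rewrite ?(proj2 (psd_gram X))//.
  by rewrite /qform bform_delta; exact: H3.
exact: nodewise_oracle.
Qed.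

Context (psil : psi <= l / 2).

Lemma nodewise_tau2_ge j : l / 2 <= t2 j.
Proof.
have [/andP[Tl TK] T0] := precision_diag_bounds j.
by have := nodewise_tau2_close j; rewrite ler_norml => /andP[]; have := psil; lra.
Qed.

Lemma nodewise_tau2_gt0 j : 0 < t2 j.
Proof. by apply: lt_le_trans (nodewise_tau2_ge j); rewrite divr_gt0. Qed.

Let Theta := Theta_lasso lam X g.

(** Off the diagonal these are the residual correlations of the nodewise lasso, at most [la] by
    optimality, divided by [t2 j >= l / 2]; on the diagonal the entry is 0. *)
Lemma Theta_gram_close j k : `|(Theta *m Sh - 1%:M) j k| <= 2 * la / l.
Proof.
have t0 := nodewise_tau2_gt0 j.
have -> : (Theta *m Sh - 1%:M) j k = (t2 j)^-1 * (Sh *m c j) k 0 - (j == k)%:R.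
  rewrite mxE; congr (_ + _); last by rewrite !mxE.
  have -> : (Theta *m Sh) j k = row j (Theta *m Sh) 0 k by rewrite [RHS]mxE.
  rewrite row_mul Theta_lassoE -scalemxAl mxE; congr (_ * _).
  have -> : (nodewise_row j (g j))^T *m Sh = (Sh *m c j)^T.
    by rewrite trmx_mul (proj1 (psd_gram X)).
  by rewrite [LHS]mxE.
case: (unliftP j k) => [i ->|->].
  rewrite (negPf (neq_lift _ _)) subr0 /c /Sh gram_nodewise_row_lift normrM.
  rewrite gtr0_norm ?invr_gt0// mulrC ler_pdivrMr//.
  apply: (@le_trans _ _ la).
    by rewrite -(lamE j); apply: lasso_grad_le; [rewrite lamE ltW|exact: Hg].
  have -> : 2 * la / l * t2 j = la * (t2 j / (l / 2)) by field; rewrite gt_eqF.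
  apply: ler_peMr; first exact: ltW.
  by rewrite ler_pdivlMr ?divr_gt0// mul1r nodewise_tau2_ge.
rewrite eqxx -[(Sh *m c j) j 0](nodewise_tau2E (Hg j)) mulVf ?gt_eqF// subrr normr0.
by rewrite divr_ge0 ?mulr_ge0// ltW.
Qed.

(** The two terms stem from the error of the row [c j] and from that of the normalization [t2 j],
    each doubled by the bound [2 a^2 + 2 b^2] for the square of a sum. *)
Let chi2 := 8 * q2 / l ^+ 2 + 8 * psi ^+ 2 / l ^+ 2 * (l^-1 + om).

Lemma qform_th_le j : qform Sh (th j) <= l^-1 + om.
Proof.
have [/andP[Tl TK] T0] := precision_diag_bounds j.
have : Th j j <= l^-1 by rewrite -[leLHS]invrK lef_pV2 ?posrE ?invr_gt0.
by have := H2 j j; rewrite -/(qform _ _) ler_norml => /andP[]; lra.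
Qed.

Let D j : 'cV[R]_p := (t2 j)^-1 *: c j - th j.

Lemma qform_Theta_close j : qform Sh (D j) <= chi2.
Proof.
have [/andP[Tl TK] T0] := precision_diag_bounds j.
have t0 := nodewise_tau2_gt0 j.
pose u := (t2 j)^-1 *: (c j - c0 j); pose v := (((Th j j)^-1 - t2 j) / t2 j) *: th j.
have -> : D j = u + v.
  rewrite /D /u /v /c0; move: (c j) (th j) => cj tj.
  by apply/colP => k; rewrite !mxE; field; rewrite !gt_eqF.
have uv : qform Sh (u + v) <= 2 * qform Sh u + 2 * qform Sh v.
  have := proj2 (psd_gram X) (u - v); rewrite !qformD.
  by rewrite /qform !(bformNl, bformNr) -/Sh; lra.
have tl : (t2 j)^-1 <= (l / 2)^-1.
  by rewrite lef_pV2 ?posrE ?divr_gt0// nodewise_tau2_ge.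
apply: (le_trans uv); rewrite /chi2 /u /v !qformZ; apply: lerD.
  have := nodewise_oracle j; have := proj2 (psd_gram X) (c j - c0 j); rewrite -/Sh.
  set q := qform _ _ => q0 qq.
  have -> : 8 * q2 / l ^+ 2 = 2 * ((l / 2)^-1 ^+ 2 * q2) by field; rewrite gt_eqF.
  rewrite ler_pM2l//; apply: ler_pM => //; first by rewrite sqr_ge0.
  by rewrite !expr2; apply: ler_pM => //; rewrite invr_ge0 ltW.
have -> : 8 * psi ^+ 2 / l ^+ 2 * (l^-1 + om) =
  2 * ((psi / (l / 2)) ^+ 2 * (l^-1 + om)) by field; rewrite gt_eqF.
rewrite ler_pM2l//; apply: ler_pM; rewrite ?sqr_ge0 ?(proj2 (psd_gram X)) ?qform_th_le//.
rewrite -real_normK ?num_real// ler_pXn2r ?nnegrE//; last first.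
  rewrite divr_ge0//; last by rewrite divr_ge0// ltW.
  by apply: le_trans (nodewise_tau2_close j).
rewrite normrM distrC normfV (gtr0_norm t0).
by apply: ler_pM => //; [rewrite invr_ge0 ltW|exact: nodewise_tau2_close].
Qed.

(** Entries of Omega^ are values of the form of [Sh] at the rows [th j + D j]. The main term is
    covered by [H2], and the terms with [D] by Cauchy-Schwarz. *)
Lemma Omega_close j k : `|(Omega_hat Theta X - Th) j k| <=
  om + 2 * Num.sqrt (chi2 * (l^-1 + om)) + chi2.
Proof.
have -> : (Omega_hat Theta X - Th) j k =
    (bform Sh (th j) (th k) - Th j k) + bform Sh (D j) (th k)
      + bform Sh (th j) (D k) + bform Sh (D j) (D k).
  rewrite mxE [(- Th) j k]mxE.
  have -> : Omega_hat Theta X j k = bform Sh (th j + D j) (th k + D k).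
    have e i : th i + D i = (row i Theta)^T.
      by rewrite /D addrC subrK Theta_lassoE linearZ/= trmxK.
    by rewrite !e /bform trmxK /Omega_hat -/Sh -!row_mul [RHS]mxE [LHS]mxE [RHS]mxE;
      apply: eq_bigr => i _; congr (_ * _); rewrite !mxE.
  by rewrite bformDl !bformDr; ring.
have CS u v a b : qform Sh u <= a -> qform Sh v <= b ->
    `|bform Sh u v| <= Num.sqrt (a * b).
  move=> ua vb; rewrite -sqrtr_sqr ler_wsqrtr//.
  apply: le_trans (bform_CauchySchwarz u v (psd_gram X)) _.
  by apply: ler_pM => //; exact: (proj2 (psd_gram X)).
have h1 := CS _ _ _ _ (qform_Theta_close j) (qform_th_le k).
have h2 := CS _ _ _ _ (qform_th_le j) (qform_Theta_close k).
have h3 := CS _ _ _ _ (qform_Theta_close j) (qform_Theta_close k).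
have chi0 : 0 <= chi2 by apply: le_trans (qform_Theta_close j); exact: (proj2 (psd_gram X)).
rewrite -expr2 sqrtr_sqr (ger0_norm chi0) in h3; rewrite mulrC in h2.
apply: (le_trans (ler_normD _ _)); apply: lerD => //.
apply: (le_trans (ler_normD _ _)).
have := ler_normD (bform Sh (th j) (th k) - Th j k) (bform Sh (D j) (th k)).
by have := H2 j k; lra.
Qed.

End nodewise_bounds.

(** * The Borel sigma-algebra of matrices *)

Section borel_matrices.
Context {R : realType}.

Lemma measurable_coord m n i j :
  measurable_fun setT (fun M : borelM R m n => (M : 'M[R]_(m, n)) i j).
Proof.
apply: (measurability _ (measurable_realfun.RGenOpens.measurableE R)) => _ [_ [a [b ->] <-]].
rewrite setTI; apply: sub_sigma_algebra.
have /continuousP : continuous (fun M : 'M[R]_(m, n) => M i j) by exact: coord_continuous.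
by apply; exact: interval_open.
Qed.

Let box m n (q : 'M[rat]_(m, n)) (e : nat) : set 'M[R]_(m, n) :=
  [set M | forall i j, `|M i j - ratr (q i j)| < e.+1%:R^-1].

(** Every open set of matrices is the union of the countably many boxes with rational centre and
    radius [1 / (e + 1)] contained in it, and the preimage of a box involves the entries only. A
    radius below [r / 2] keeps a box around the point inside the ball of radius [r]. *)
Lemma measurable_borelM d (T : measurableType d) m n (f : T -> borelM R m n) :
  (forall i j, measurable_fun setT (fun w => (f w : 'M[R]_(m, n)) i j)) ->
  measurable_fun setT f.
Proof.
move=> mf.
apply: (@measurability _ _ T (borelM R m n) setT f (@open 'M[R]_(m, n)) erefl).
move=> _ [A oA <-].
rewrite setTI.
have mbox q e : measurable (f @^-1` box q e).
  have -> : f @^-1` box q e = \bigcap_(ij in [set: 'I_m * 'I_n])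
     ((fun w => (f w : 'M[R]_(m, n)) ij.1 ij.2) @^-1`
        `]ratr (q ij.1 ij.2) - e.+1%:R^-1, ratr (q ij.1 ij.2) + e.+1%:R^-1[%classic).
    apply/seteqP; split=> [w H [i j] _|w H i j] /=.
      by rewrite in_itv/= -ltr_distlC distrC; exact: H.
    by rewrite distrC ltr_distlC; have := H (i, j) I; rewrite /= in_itv.
  apply: fin_bigcap_measurable; first exact: finite_finset.
  by move=> ij _; rewrite -[X in measurable X]setTI; exact: mf.
have -> : f @^-1` A = \bigcup_k (if unpickle k is Some (q, e) then
    (if `[< box q e `<=` A >] then f @^-1` box q e else set0) else set0).
  apply/seteqP; split=> [w /= Aw|w [k _]]; last first.
    by case: unpickle => [[q e]|//]; case: asboolP => // sub; exact: sub.
  have /nbhs_ballP[r /= r0 rA] : nbhs (f w : 'M[R]_(m, n)) A by exact: open_nbhs_nbhs.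
  have [e er] : exists e : nat, e.+1%:R^-1 < r / 2.
    have r20 : 0 < r / 2 by rewrite divr_gt0.
    by have [e _ /(_ _ (leqnn _)) ?] := near_infty_natSinv_lt (PosNum r20); exists e.
  have ex i j : exists x : rat, `|(f w : 'M[R]_(m, n)) i j - ratr x| < e.+1%:R^-1.
    have e0 : 0 < e.+1%:R^-1 :> R by rewrite invr_gt0.
    have lt : (f w : 'M[R]_(m, n)) i j - e.+1%:R^-1 < (f w : 'M[R]_(m, n)) i j + e.+1%:R^-1.
      by rewrite ltrD2l gtrN.
    have [x] := rat_in_itvoo lt.
    by rewrite in_itv/= -ltr_distlC => ?; exists x.
  pose q := \matrix_(i, j) xchoose (ex i j).
  have qw : box q e (f w) by move=> i j; rewrite mxE; exact: (xchooseP (ex i j)).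
  exists (pickle (q, e)) => //; rewrite pickleK.
  suff -> : `[< box q e `<=` A >] by exact: qw.
  apply/asboolP => M qM; apply: rA; split => // i j.
  rewrite /ball /=; have := qw i j; have := qM i j => h1 h2.
  have := ler_normD ((f w : 'M[R]_(m, n)) i j - ratr (q i j)) (ratr (q i j) - M i j).
  rewrite addrA subrK [`|ratr _ - _|]distrC => h3; apply: (le_lt_trans h3).
  rewrite [ltRHS]splitr; apply: ltrD; apply: (lt_trans _ er) => //.
apply: bigcupT_measurable => k; case: unpickle => [[q e]|//].
by case: ifP.
Qed.

Lemma measurable_entry d (T : measurableType d) m n (f : T -> borelM R m n) i j :
  measurable_fun setT f -> measurable_fun setT (fun w => (f w : 'M[R]_(m, n)) i j).
Proof. by move=> mf; exact: (measurableT_comp (measurable_coord i j) mf). Qed.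

Lemma measurable_gt_cst d (T : measurableType d) (f : T -> R) c :
  measurable_fun setT f -> measurable [set w | c < f w].
Proof.
move=> mf; rewrite -[X in measurable X]setTI.
have -> : [set w | c < f w] = f @^-1` `]c, +oo[%classic.
  by apply/seteqP; split=> w /=; rewrite in_itv/= andbT.
exact: mf.
Qed.

Lemma measurable_ge_cst d (T : measurableType d) (f : T -> R) c :
  measurable_fun setT f -> measurable [set w | c <= f w].
Proof.
move=> mf; rewrite -[X in measurable X]setTI.
have -> : [set w | c <= f w] = f @^-1` `[c, +oo[%classic.
  by apply/seteqP; split=> w /=; rewrite in_itv/= andbT.
exact: mf.
Qed.

Lemma measurable_le_cst d (T : measurableType d) (f : T -> R) c :
  measurable_fun setT f -> measurable [set w | f w <= c].
Proof.
move=> mf; rewrite -[X in measurable X]setTI.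
have -> : [set w | f w <= c] = f @^-1` `]-oo, c]%classic.
  by apply/seteqP; split=> w /=; rewrite in_itv.
exact: mf.
Qed.

Lemma measurable_mulmx d (T : measurableType d) m n p
    (f : T -> 'M[R]_(m, n)) (g : T -> 'M[R]_(n, p)) :
  (forall i j, measurable_fun setT (fun w => f w i j)) ->
  (forall i j, measurable_fun setT (fun w => g w i j)) ->
  forall i j, measurable_fun setT (fun w => (f w *m g w) i j).
Proof.
move=> mf mg i j.
have -> : (fun w => (f w *m g w) i j) = (fun w => \sum_k f w i k * g w k j).
  by apply/funext => w; rewrite mxE.
by apply: measurable_sum => k; exact: measurable_funM.
Qed.

End borel_matrices.

(** * Change of variables with a density *)

Section density_transfer.
Local Open Scope ereal_scope.
Context {R : realType} d d1 (T : measurableType d) (T1 : measurableType d1).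
Context (mu : {measure set T -> \bar R}) (nu : {measure set T1 -> \bar R}).
Context (Z : T -> T1) (mZ : measurable_fun setT Z).
Context (g : T -> R) (mg : measurable_fun setT g) (g0 : forall w, (0 <= g w)%R).
Context (gE : forall A, measurable A ->
  \int[mu]_w (\1_A (Z w) * g w)%:E = nu A).

Import HBNNSimple.

(** Extends [gE] from indicators to nonnegative functions by simple approximation. It is used for
    Gaussian densities, with [Z] the identity, and in the product formula for independent variables,
    with the remaining factors as [g]. *)
Lemma ge0_integral_density_pushforward (f : T1 -> \bar R) :
  measurable_fun setT f -> (forall x, 0 <= f x) ->
  \int[mu]_w (f (Z w) * (g w)%:E) = \int[nu]_x f x.
Proof.
move=> mf f0; pose h := nnsfun_approx measurableT mf.
have mgE : measurable_fun setT (EFin \o g) by exact/measurable_EFinP.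
have -> : \int[nu]_x f x = limn (fun n => \int[nu]_x (EFin \o h n) x).
  have fE x : f x = limn (fun n => (EFin \o h n) x).
    by apply/esym/cvg_lim => //; exact: cvg_nnsfun_approx.
  under eq_integral do rewrite fE.
  apply: monotone_convergence => //.
  - by move=> n; exact/measurable_EFinP.
  - by move=> n x _; rewrite lee_fin.
  - by move=> x _ a b ab; rewrite lee_fin; exact/lefP/nd_nnsfun_approx.
have -> : \int[mu]_w (f (Z w) * (g w)%:E) =
    limn (fun n => \int[mu]_w ((h n (Z w))%:E * (g w)%:E)).
  have fE w : f (Z w) * (g w)%:E = limn (fun n => (h n (Z w))%:E * (g w)%:E).
    apply/esym/cvg_lim => //; apply: cvgeZr => //.
    exact: (cvg_nnsfun_approx measurableT mf).
  under eq_integral do rewrite fE.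
  apply: monotone_convergence => //.
  - move=> n; apply: emeasurable_funM => //.
    by apply/measurable_EFinP; exact: measurableT_comp.
  - by move=> n x _; rewrite mule_ge0 ?lee_fin.
  - move=> x _ a b ab; rewrite lee_wpmul2r ?lee_fin//; exact/lefP/nd_nnsfun_approx.
congr (limn _); apply/funext => n; set k := h n.
have mk r : measurable (k @^-1` [set r]) by exact: measurable_sfunP.
transitivity (\int[nu]_x
   (\sum_(y \in range k) (y * \1_(k @^-1` [set y]) x)%:E)); last first.
  by apply: eq_integral => t _; rewrite /= fimfunE -fsumEFin.
have indich r : measurable_fun setT (fun x => (r * \1_(k @^-1` [set r]) x)%:E).
  by apply/measurable_EFinP; exact: measurable_funM.
rewrite [RHS]ge0_integral_fsum//; last by move=> m y _; exact: nnfun_muleindic_ge0.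
transitivity (\int[mu]_w (\sum_(y \in range k)
    ((y * \1_(k @^-1` [set y]) (Z w))%:E * (g w)%:E))).
  apply: eq_integral => w _.
  rewrite -ge0_mule_fsuml => [|y]; last exact: nnfun_muleindic_ge0.
  by rewrite fsumEFin // -(fimfunE _ (Z w)).
rewrite ge0_integral_fsum//; last 2 first.
  - move=> y; apply: emeasurable_funM => //.
    exact: (measurableT_comp (indich y) mZ).
  - move=> m y _; rewrite mule_ge0 ?lee_fin//.
    by have := nnfun_muleindic_ge0 k m (Z y); rewrite lee_fin.
apply: eq_fsbigr => r rhn.
have r0 : (0 <= r)%R by move: rhn; rewrite inE => -[x _ <-].
under eq_integral do rewrite -EFinM -mulrA EFinM.
under [in RHS]eq_integral do rewrite EFinM.
rewrite !ge0_integralZl//.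
- by rewrite gE// integral_indic// setIT.
- by apply/measurable_EFinP.
- apply/measurable_EFinP/measurable_funM => //.
  exact: (measurableT_comp (measurable_indic _) mZ).
- by move=> w _; rewrite lee_fin mulr_ge0.
Qed.

End density_transfer.

(** * Gaussian moments *)

Section gaussian_moments.
Context {R : realType}.
Implicit Types m s t v x : R.

Lemma invf_1B_le_exp x : x <= 1 / 2 -> (1 - x)^-1 <= expR (x + 2 * x ^+ 2).
Proof.
move=> x2; apply: (@le_trans _ _ (1 + (x + 2 * x ^+ 2))); last exact: expR_ge1Dx.
rewrite -[leLHS]mul1r ler_pdivrMr; last by lra.
have : 0 <= x ^+ 2 * (1 - 2 * x) by rewrite mulr_ge0 ?sqr_ge0//; lra.
by lra.
Qed.

(** Precision of the tilted Gaussian relative to the original one, [s] being the standard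
    deviation. *)
Let tilt t s := 1 - 2 * t * s ^+ 2.

(* Completing the square: tilting a Gaussian by [expR (t * x ^+ 2)] gives a multiple
   of another Gaussian. *)
Lemma expR_sqr_normal_pdf m s t x : s != 0 -> 0 < tilt t s ->
  expR (t * x ^+ 2) * normal_pdf m s x =
  (Num.sqrt (tilt t s))^-1 * expR (t * m ^+ 2 / tilt t s) *
  normal_pdf (m / tilt t s) (s / Num.sqrt (tilt t s)) x.
Proof.
move=> s0 a0; set a := tilt t s in a0 *.
have sa0 : Num.sqrt a != 0 by rewrite gt_eqF// sqrtr_gt0.
have s'0 : s / Num.sqrt a != 0 by rewrite mulf_neq0// invr_neq0.
rewrite !normal_pdfE// /normal_peak /normal_fun.
have aE : Num.sqrt a ^+ 2 = a by rewrite sqr_sqrtr// ltW.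
have -> : (Num.sqrt ((s / Num.sqrt a) ^+ 2 * pi *+ 2))^-1 =
    Num.sqrt a * (Num.sqrt (s ^+ 2 * pi *+ 2))^-1.
  have -> : (s / Num.sqrt a) ^+ 2 * pi *+ 2 = a^-1 * (s ^+ 2 * pi *+ 2).
    by rewrite exprMn exprVn aE -!mulrnAr mulrAC mulrC.
  by rewrite sqrtrM ?invr_ge0 ?ltW// sqrtrV ?ltW// invfM invrK.
rewrite [in RHS]mulrACA [_^-1 * (_ * _)]mulrA mulVf// mul1r.
rewrite [LHS]mulrCA -!expRD; congr (_ * expR _).
rewrite exprMn exprVn aE.
have -> : a = 1 - 2 * t * s ^+ 2 by [].
by rewrite /a /tilt in a0; field; rewrite s0 /= gt_eqF.
Qed.

Lemma integral_expR_sqr_normal_pdf m s t : s != 0 -> 0 < tilt t s ->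
  (\int[lebesgue_measure]_x (expR (t * x ^+ 2) * normal_pdf m s x)%:E)%E =
  ((Num.sqrt (tilt t s))^-1 * expR (t * m ^+ 2 / tilt t s))%:E.
Proof.
move=> s0 a0.
under eq_integral do rewrite expR_sqr_normal_pdf// EFinM.
rewrite ge0_integralZl//=.
- by rewrite integral_normal_pdf mule1.
- by apply/measurable_EFinP; exact: measurable_normal_pdf.
- by move=> x _; rewrite lee_fin normal_pdf_ge0.
Qed.

Lemma measurable_expR_sqr d (T : measurableType d) (Z : T -> R) t :
  measurable_fun setT Z -> measurable_fun setT (fun w => expR (t * Z w ^+ 2)).
Proof.
move=> mZ; apply: measurableT_comp => //; apply: measurable_funM => //.
exact: measurable_funX.
Qed.

(** The square root contributes [t s^2 + 4 t^2 s^4] and the exponential [t m^2 + 4 t^2 s^2 m^2];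
    both fit into the bound in the second moment [m^2 + s^2]. Negative [t] is included, as it serves
    the lower deviations. *)
Lemma tilted_mass_le m s t : t * (m ^+ 2 + s ^+ 2) <= 1 / 4 ->
  0 < tilt t s /\ (Num.sqrt (tilt t s))^-1 * expR (t * m ^+ 2 / tilt t s) <=
  expR (t * (m ^+ 2 + s ^+ 2) + 4 * t ^+ 2 * (m ^+ 2 + s ^+ 2) ^+ 2).
Proof.
move=> tV; pose x := 2 * t * s ^+ 2.
have m2 := sqr_ge0 m; have s2 := sqr_ge0 s.
have x2 : x <= 1 / 2.
  rewrite /x; have [t0|t0] := lerP 0 t.
    by have := mulr_ge0 t0 m2; lra.
  have : 0 <= - t * s ^+ 2 by rewrite mulr_ge0//; lra.
  by lra.
have aE : tilt t s = 1 - x by [].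
have a0 : 0 < tilt t s by rewrite aE; lra.
split=> //; rewrite aE in a0 *.
have h1 : (Num.sqrt (1 - x))^-1 <= expR (x / 2 + x ^+ 2).
  rewrite -(@ler_pXn2r _ 2)// ?nnegrE ?invr_ge0 ?sqrtr_ge0 ?expR_ge0//.
  rewrite exprVn sqr_sqrtr; last exact: ltW.
  apply: le_trans (invf_1B_le_exp x2) _.
  by rewrite -expRM_natl ler_expR; lra.
have h2 : t * m ^+ 2 / (1 - x) <= t * m ^+ 2 + 4 * t ^+ 2 * s ^+ 2 * m ^+ 2.
  rewrite ler_pdivrMr//.
  have -> : (t * m ^+ 2 + 4 * t ^+ 2 * s ^+ 2 * m ^+ 2) * (1 - x) =
    t * m ^+ 2 + 2 * ((t * s * m) ^+ 2 * (1 - 2 * x)) by rewrite /x; ring.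
  by rewrite lerDl mulr_ge0// mulr_ge0 ?sqr_ge0//; lra.
apply: (@le_trans _ _ (expR (x / 2 + x ^+ 2) *
   expR (t * m ^+ 2 + 4 * t ^+ 2 * s ^+ 2 * m ^+ 2))).
  by apply: ler_pM; rewrite ?invr_ge0 ?sqrtr_ge0 ?expR_ge0 ?ler_expR.
rewrite -expRD ler_expR /x.
have : 0 <= t ^+ 2 * m ^+ 2 * (m ^+ 2 + s ^+ 2).
  by apply: mulr_ge0; [apply: mulr_ge0; exact: sqr_ge0|exact: addr_ge0].
by lra.
Qed.

Section random_variable.
Context d (T : measurableType d) (P : probability T R) (Z : T -> R) (m v : R).
Context (mZ : measurable_fun setT Z) (v0 : 0 <= v).
Context (ZE : forall A, measurable A -> P (Z @^-1` A) = normal_law m v A).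
Let V := m ^+ 2 + v.

Lemma normal_law_expR_sqr_le t : t * V <= 1 / 4 ->
  (\int[P]_w (expR (t * Z w ^+ 2))%:E <= (expR (t * V + 4 * t ^+ 2 * V ^+ 2))%:E)%E.
Proof.
move=> tV; pose f (x : measurableTypeR R) := (expR (t * (x : R) ^+ 2))%:E.
have mf : measurable_fun setT f.
  by apply/measurable_EFinP; apply: measurable_expR_sqr.
have f0 x : (0 <= f x)%E by rewrite lee_fin expR_ge0.
(* [R] and [measurableTypeR R] have the same measurable sets but different displays;
   [normal_prob] and [lebesgue_measure] live on the latter. *)
pose Z' : T -> measurableTypeR R := Z.
have mZ' : measurable_fun setT Z' by exact: mZ.
have -> : (\int[P]_w (expR (t * Z w ^+ 2))%:E = \int[pushforward P Z']_x f x)%E.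
  by rewrite ge0_integral_pushforward.
have [v00|vn0] := eqVneq v 0.
  rewrite (eq_measure_integral (dirac (m : measurableTypeR R))); last first.
    by move=> A mA _; apply: (etrans (ZE mA)); rewrite /normal_law v00 eqxx.
  rewrite integral_dirac// diracT mul1e lee_fin ler_expR /V v00 addr0 lerDl.
  by rewrite -mulrA -exprMn mulr_ge0 ?sqr_ge0.
have s2 : Num.sqrt v ^+ 2 = v by rewrite sqr_sqrtr.
have s0 : Num.sqrt v != 0 by rewrite gt_eqF// sqrtr_gt0 lt_neqAle eq_sym vn0.
rewrite (eq_measure_integral (normal_prob m (Num.sqrt v))); last first.
  by move=> A mA _; apply: (etrans (ZE mA)); rewrite /normal_law (negPf vn0).
rewrite -(@ge0_integral_density_pushforward _ _ _ _ _ lebesgue_measure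
   (normal_prob m (Num.sqrt v)) id _ (normal_pdf m (Num.sqrt v)))//.
- under eq_integral do rewrite -EFinM.
  have [a0 le] := @tilted_mass_le m (Num.sqrt v) t ltac:(by rewrite s2).
  by rewrite integral_expR_sqr_normal_pdf// lee_fin; apply: le_trans le _; rewrite s2.
- exact: measurable_normal_pdf.
- by move=> x; exact: normal_pdf_ge0.
- move=> A mA; rewrite /normal_prob [RHS]integral_mkcond; apply: eq_integral => x _.
  by rewrite epatch_indic/= EFinM muleC.
Qed.

(* The bound on [E exp(t Z^2)] at small [t] of both signs, compared with
   [1 + y <= exp y], pins down [E Z^2]. *)
Lemma normal_law_sqr : (\int[P]_w (Z w ^+ 2)%:E = V%:E)%E.
Proof.
have V0 : 0 <= V by rewrite addr_ge0 ?sqr_ge0.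
have mZ2 : measurable_fun setT (fun w => (Z w ^+ 2)%:E).
  by apply/measurable_EFinP; exact: measurable_funX.
have Z20 w : (0 <= (Z w ^+ 2)%:E)%E by rewrite lee_fin sqr_ge0.
have me t : measurable_fun setT (fun w => (expR (t * Z w ^+ 2))%:E).
  by apply/measurable_EFinP; exact: measurable_expR_sqr.
(* Keeps [t * V] below 1 / 8; the added 1 covers [V = 0]. *)
pose t0 := (8 * (V + 1))^-1.
have t00 : 0 < t0 by rewrite invr_gt0; lra.
have t0V t : 0 < t -> t <= t0 -> t * V <= 1 / 8.
  move=> tp tt; apply: (@le_trans _ _ (t0 * V)); first by rewrite ler_wpM2r.
  by rewrite /t0 mulrC ler_pdivrMr; lra.
have up t : 0 < t -> t <= t0 ->
   (t%:E * \int[P]_w (Z w ^+ 2)%:E + 1 <= (expR (t * V + 4 * t ^+ 2 * V ^+ 2))%:E)%E.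
  move=> tp tt; have tV := t0V _ tp tt.
  apply: le_trans (normal_law_expR_sqr_le (t := t) _); last by lra.
  have te : (0 <= t%:E)%E by rewrite lee_fin ltW.
  rewrite -ge0_integralZl//.
  rewrite -(mul1e 1%E) -{2}(@probability_setT _ _ _ P) -integral_cst// -ge0_integralD//.
  - apply: ge0_le_integral => //.
    + by move=> w _; rewrite adde_ge0// mule_ge0// lee_fin ltW.
    + by apply: emeasurable_funD => //; exact: measurable_funeM.
    + by move=> w _; rewrite -EFinM -EFinD lee_fin addrC; exact: expR_ge1Dx.
  - by move=> w _; rewrite mule_ge0// lee_fin ltW.
  - exact: measurable_funeM.
(* The upper bound at [t0] also shows that the second moment is finite, so that it can be handled as
   a real number [q]. *)
have fin : (\int[P]_w (Z w ^+ 2)%:E)%E \is a fin_num.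
  rewrite ge0_fin_numE ?integral_ge0//.
  have := up t0 t00 (lexx _); case: (\int[P]_w _)%E => [r|//|//]; first by rewrite ltry.
  by rewrite gt0_muley// lte_fin.
move: (fin) up => /fineK <-; set q := fine _ => up.
have lo t : 0 < t -> t <= t0 -> 1 <= expR (- t * V + 4 * t ^+ 2 * V ^+ 2) + t * q.
  move=> tp tt; rewrite -lee_fin EFinD.
  have tV := t0V _ tp tt; have tV0 : 0 <= t * V by rewrite mulr_ge0// ltW.
  have := @normal_law_expR_sqr_le (- t) ltac:(lra); rewrite sqrrN => H.
  apply: le_trans (leeD2r (t * q)%:E H).
  have te : (0 <= t%:E)%E by rewrite lee_fin ltW.
  rewrite EFinM fineK// -ge0_integralZl// -ge0_integralD//.
  - rewrite -(mul1e 1%E) -{2}(@probability_setT _ _ _ P) -integral_cst//.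
    apply: ge0_le_integral => //.
    + by apply: emeasurable_funD => //; exact: measurable_funeM.
    + move=> w _; rewrite -EFinM -EFinD lee_fin.
      by have := expR_ge1Dx (- t * Z w ^+ 2); lra.
  - by move=> w _; rewrite mule_ge0// lee_fin ltW.
  - exact: measurable_funeM.
(* With [w = t * V] and [y = w + 4 w^2 <= 3 w / 2], the bound [exp y <= 1 + y + 2 y^2] leaves an
   excess of [8.5 w^2] over [w], rounded up to [9 w^2]. *)
have up' t : 0 < t -> t <= t0 -> q <= V + t * (9 * V ^+ 2).
  move=> tp tt; have := up t tp tt; rewrite -EFinM -EFinD lee_fin => h.
  have tV := t0V _ tp tt; have tV0 : 0 <= t * V by rewrite mulr_ge0// ltW.
  set w := t * V in tV tV0.
  have wE : t * V + 4 * t ^+ 2 * V ^+ 2 = w + 4 * w ^+ 2 by rewrite /w; ring.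
  have w2 : w ^+ 2 <= w / 8 by rewrite expr2 ler_wpM2l//; lra.
  have w20 := sqr_ge0 w.
  rewrite wE in h; set y := w + 4 * w ^+ 2 in h.
  have e1 : expR y * (1 - y) <= 1.
    rewrite -[leRHS](expRxMexpNx_1 y) ler_pM2l ?expR_gt0//.
    by have := expR_ge1Dx (- y); lra.
  have e2 : expR y <= 1 + y + 2 * y ^+ 2.
    have y1 : 0 < 1 - y by rewrite /y; lra.
    rewrite -(ler_pM2r y1); apply: (le_trans e1).
    have : 0 <= y ^+ 2 * (1 - 2 * y) by rewrite mulr_ge0 ?sqr_ge0//; rewrite /y; lra.
    by lra.
  have y2 : y ^+ 2 <= 9 / 4 * w ^+ 2.
    have -> : 9 / 4 * w ^+ 2 = (3 / 2 * w) ^+ 2 by field.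
    by rewrite ler_pXn2r ?nnegrE// /y; lra.
  rewrite -(ler_pM2l tp).
  have -> : t * (V + t * (9 * V ^+ 2)) = w + 9 * w ^+ 2 by rewrite /w; ring.
  rewrite /y in e2 y2 h *; lra.
have lo' t : 0 < t -> t <= t0 -> V - t * (9 * V ^+ 2) <= q.
  move=> tp tt; have h := lo t tp tt.
  have tV := t0V _ tp tt; have tV0 : 0 <= t * V by rewrite mulr_ge0// ltW.
  set w := t * V in tV tV0.
  have wE : - t * V + 4 * t ^+ 2 * V ^+ 2 = - (w - 4 * w ^+ 2) by rewrite /w; ring.
  have w2 : w ^+ 2 <= w / 8 by rewrite expr2 ler_wpM2l//; lra.
  have w20 := sqr_ge0 w.
  rewrite wE in h; set y := w - 4 * w ^+ 2 in h.
  have y0 : 0 <= y by rewrite /y; lra.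
  have e1 : expR (- y) * (1 + y) <= 1.
    rewrite mulrC -[leRHS](expRxMexpNx_1 y) ler_pM2r ?expR_gt0//.
    exact: expR_ge1Dx.
  have e2 : expR (- y) <= 1 - y + y ^+ 2.
    have y1 : 0 < 1 + y by lra.
    rewrite -(ler_pM2r y1); apply: (le_trans e1).
    have : 0 <= y ^+ 3 by rewrite exprn_ge0.
    by lra.
  have y2 : y ^+ 2 <= w ^+ 2 by rewrite ler_pXn2r ?nnegrE// /y; lra.
  rewrite -(ler_pM2l tp).
  have -> : t * (V - t * (9 * V ^+ 2)) = w - 9 * w ^+ 2 by rewrite /w; ring.
  rewrite /y in e2 y2 h *; lra.
have small e : 0 < e -> exists2 t, 0 < t /\ t <= t0 & t * (9 * V ^+ 2) <= e.
  move=> e0; pose D := 9 * V ^+ 2 + 1.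
  have D0 : 0 < D by rewrite /D ltr_wpDl// mulr_ge0 ?sqr_ge0.
  exists (Num.min t0 (e / D)).
    by rewrite lt_min t00 divr_gt0//= ge_min lexx.
  apply: (@le_trans _ _ (Num.min t0 (e / D) * D)).
    apply: ler_wpM2l; last by rewrite /D lerDl.
    by rewrite le_min !ltW// divr_gt0.
  by rewrite -ler_pdivlMr// ge_min lexx orbT.
congr EFin; apply/eqP; rewrite eq_le; apply/andP; split.
  apply/ler_addgt0Pr => e e0; have [t [tp tt] te] := small e e0.
  by have := up' t tp tt; lra.
apply/ler_addgt0Pr => e e0; have [t [tp tt] te] := small e e0.
by have := lo' t tp tt; lra.
Qed.

End random_variable.
End gaussian_moments.

(** * Independence *)

Section independence.
Context {R : realType} d (T : measurableType d) (P : probability T R).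

Section product.
Context d1 (T1 : measurableType d1) (I : finType) (Z : I -> T -> T1).
Context (mZ : forall i, measurable_fun setT (Z i)) (indep : mutually_independent P Z).
Context (f : I -> T1 -> R) (mf : forall i, measurable_fun setT (f i)).
Context (f0 : forall i x, 0 <= f i x) (c : I -> R).
Context (fc : forall i, (\int[P]_w (f i (Z i w))%:E = (c i)%:E)%E).

Let c0 i : 0 <= c i.
Proof. by rewrite -lee_fin -fc integral_ge0// => w _; rewrite lee_fin. Qed.

(* Independence is stated for sets, so the indicators [\1_(A i)] are replaced by the
   functions [f i] one index at a time. *)
Lemma expectation_prod_indep_partial (s : seq I) (A : I -> set T1) :
  uniq s -> (forall i, measurable (A i)) ->
  (\int[P]_w (\prod_(i <- s) f i (Z i w) * \prod_(i | i \notin s) \1_(A i) (Z i w))%:E =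
   (\prod_(i <- s) c i * \prod_(i | i \notin s) fine (P (Z i @^-1` A i)))%:E)%E.
Proof.
have mP i B : measurable B -> measurable (Z i @^-1` B).
  by move=> mB; rewrite -[X in measurable X]setTI; exact: mZ.
elim: s A => [|k s IH] A /=; first move=> _ mA.
  rewrite !big_nil !mul1r.
  under eq_integral do rewrite big_nil mul1r.
  have E w : \prod_(i | i \notin [::]) \1_(A i) (Z i w) =
      \1_(\bigcap_(i in [set i | i \in [set: I]%SET]) (Z i @^-1` A i)) w :> R.
    set B := \bigcap_(i in _) _; have [H|H] := pselect (B w).
      rewrite [RHS]indicE mem_set// big1// => i _; rewrite indicE mem_set//.
      by apply: H; rewrite /= inE.
    rewrite [RHS]indicE memNset//; apply/eqP/prodf_eq0.
    have [i /not_implyP[_ Hi]] : exists i, ~ (i \in [set: I]%SET -> (Z i @^-1` A i) w).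
      by apply/existsNP.
    by exists i => //; rewrite indicE memNset.
  under eq_integral do rewrite E.
  rewrite integral_indic// ?setIT; last first.
    by apply: fin_bigcap_measurable => // i _; exact: mP.
  apply: (etrans (indep [set: I]%SET mA)); rewrite -prodEFin.
  rewrite (eq_bigl (fun i => i \notin [::])); last by move=> i; rewrite inE.
  by apply: eq_bigr => i _; rewrite fineK// fin_num_measure//; exact: mP.
move=> /andP[ks us] mA.
have split_k (F : I -> R) :
    \prod_(i | i \notin s) F i = F k * \prod_(i | i \notin k :: s) F i.
  rewrite (bigD1 k)//=; congr (_ * _); apply: eq_bigl => i.
  by rewrite inE negb_or andbC.
pose g w := \prod_(i <- s) f i (Z i w) * \prod_(i | i \notin k :: s) \1_(A i) (Z i w).
have g0 w : 0 <= g w.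
  by rewrite mulr_ge0 ?prodr_ge0.
have mg : measurable_fun setT g.
  apply: measurable_funM.
    by apply: measurable_prod => i _; exact: (measurableT_comp (mf i) (mZ i)).
  under eq_fun do rewrite -big_filter.
  apply: measurable_prod => i _.
  exact: (measurableT_comp (measurable_indic (mA i)) (mZ i)).
pose C := \prod_(i <- s) c i * \prod_(i | i \notin k :: s) fine (P (Z i @^-1` A i)).
have C0 : 0 <= C.
  by rewrite mulr_ge0 ?prodr_ge0// => i _; rewrite fine_ge0.
pose Zk : {mfun T >-> T1} := HB.pack (Z k) (isMeasurableFun.Build _ _ _ _ _ (mZ k)).
pose nu := mscale (NngNum C0) (distribution P Zk).
(* The induction hypothesis with [A k] replaced by [B]: weighting by [g] turns the law of [Z k] into
   a multiple of itself, so [f k] can be integrated against it. *)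
have gE B : measurable B -> (\int[P]_w (\1_B (Z k w) * g w)%:E = nu B)%E.
  move=> mB; pose A' i := if i == k then B else A i.
  have mA' i : measurable (A' i) by rewrite /A'; case: ifP.
  have := IH A' us mA'; rewrite split_k.
  have -> : \prod_(i | i \notin k :: s) fine (P (Z i @^-1` A' i)) =
      \prod_(i | i \notin k :: s) fine (P (Z i @^-1` A i)).
    by apply: eq_bigr => i; rewrite inE negb_or /A' => /andP[/negPf ->].
  have A'k : A' k = B by rewrite /A' eqxx.
  rewrite mulrCA -/C A'k EFinM fineK ?fin_num_measure//; last exact: mP.
  move=> H; rewrite /nu /mscale/= muleC -H; apply: eq_integral => w _; congr EFin.
  rewrite split_k A'k /g [RHS]mulrCA; congr (_ * (_ * _)).
  by apply: eq_bigr => i; rewrite inE negb_or /A' => /andP[/negPf ->].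
have mfk : measurable_fun setT (EFin \o f k) by exact/measurable_EFinP.
have := ge0_integral_density_pushforward (mZ k) mg g0 gE mfk.
rewrite /nu => H; transitivity (\int[P]_w ((EFin \o f k) (Z k w) * (g w)%:E))%E.
  by apply: eq_integral => w _; rewrite /g /= -EFinM big_cons mulrA.
rewrite H; last by move=> x; rewrite lee_fin f0.
rewrite ge0_integral_mscale//=; last by move=> x _; rewrite lee_fin f0.
rewrite ge0_integral_distribution//=; last by move=> x; rewrite lee_fin f0.
by rewrite fc -EFinM big_cons /C; congr EFin; rewrite -mulrA mulrC mulrA.
Qed.

Lemma expectation_prod_indep :
  (\int[P]_w (\prod_i f i (Z i w))%:E = (\prod_i c i)%:E)%E.
Proof.
have := @expectation_prod_indep_partial (index_enum I) (fun=> setT)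
  (index_enum_uniq I) (fun=> measurableT).
rewrite [X in _ * X]big_pred0 ?mulr1 => [<-|i]; last by rewrite mem_index_enum.
apply: eq_integral => w _; rewrite [X in _ * X]big_pred0 ?mulr1//.
by move=> i; rewrite mem_index_enum.
Qed.

End product.

(** The factor [t] is kept inside the event so that negative [t] yields the lower tail. *)
Lemma chernoff (S : T -> R) t a : measurable_fun setT S ->
  (P [set w | (t * a <= t * S w)%R] * (expR (t * a)%R)%:E <=
   \int[P]_w (expR (t * S w)%R)%:E)%E.
Proof.
move=> mS; set A := [set w | _].
have mE : measurable_fun setT (fun w => t * S w) by exact: measurable_funM.
have mA : measurable A by exact: measurable_ge_cst.
have -> : P A = (\int[P]_w (\1_A w)%:E)%E by rewrite integral_indic// setIT.
have mI : measurable_fun setT (fun w => (\1_A w : R)%:E).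
  by apply/measurable_EFinP; exact: measurable_indic.
have e0 : (0 <= (expR (t * a))%:E)%E by rewrite lee_fin expR_ge0.
rewrite muleC -ge0_integralZl//.
apply: ge0_le_integral => //.
- exact: measurable_funeM.
- by apply/measurable_EFinP; exact: measurableT_comp.
move=> w _; rewrite -EFinM lee_fin indicE; have [/set_mem Aw|_] := boolP (w \in A).
  by rewrite mulr1 ler_expR.
by rewrite mulr0 expR_ge0.
Qed.

End independence.

(** * Concentration of the Gram matrix *)

Section gaussian_design.
Context {R : realType} d (T : measurableType d) (P : probability T R) (n p : nat).
Context (X : {RV P >-> borelM R n p}) (m : 'cV[R]_p) (G : 'M[R]_p).
Context (indep : mutually_independent P (row_vec X)).
Context (normal : forall i, mvnormal (pushforward P (row_vec X i)) m G).
Context (n0 : (0 < n)%N).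

Let proj (u : 'cV[R]_p) (x : 'cV[R]_p) : R := (u^T *m x) 0 0.
(** The second moment of [proj u] under the law of a row, mean included. *)
Let V u := proj u m ^+ 2 + qform G u.

Lemma measurable_row_vec i : measurable_fun setT (row_vec X i).
Proof.
apply: measurable_borelM => j k; rewrite /row_vec.
have -> : (fun w => ((row i (X w : 'M[R]_(n, p)))^T : 'cV[R]_p) j k) =
    (fun w => (X w : 'M[R]_(n, p)) i j).
  by apply/funext => w; rewrite !mxE.
exact: measurable_entry.
Qed.

Lemma measurable_proj u : measurable_fun setT (proj u : borelM R p 1 -> R).
Proof.
rewrite /proj; apply: measurable_mulmx => i j; first exact: measurable_cst.
exact: measurable_coord.
Qed.

Lemma measurable_proj_row u i : measurable_fun setT (fun w => proj u (row_vec X i w)).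
Proof. exact: (measurableT_comp (measurable_proj u) (measurable_row_vec i)). Qed.

Lemma proj_rowE u i w : proj u (row_vec X i w) = ((X w : 'M[R]_(n, p)) *m u) i 0.
Proof.
by rewrite /proj /row_vec !mxE; apply: eq_bigr => j _; rewrite !mxE mulrC.
Qed.

Lemma qform_gram_rows u w :
  qform (gram (X w : 'M[R]_(n, p))) u = n%:R^-1 * \sum_i proj u (row_vec X i w) ^+ 2.
Proof.
rewrite qform_gram mulrC; congr (_ * _); apply: eq_bigr => i _.
by rewrite proj_rowE.
Qed.

Lemma measurable_qform_gram u :
  measurable_fun setT (fun w => qform (gram (X w : 'M[R]_(n, p))) u).
Proof.
rewrite (_ : (fun w => _) = fun w => n%:R^-1 * \sum_i proj u (row_vec X i w) ^+ 2).
  apply: measurable_funM => //; apply: measurable_sum => i.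
  by apply: measurable_funX; exact: measurable_proj_row.
by apply/funext => w; exact: qform_gram_rows.
Qed.

Lemma proj_row_law u i A : measurable A ->
  P ((fun w => proj u (row_vec X i w)) @^-1` A) = normal_law (proj u m) (qform G u) A.
Proof. by move=> mA; have [_ _ H] := normal i; exact: (H u A mA). Qed.

Lemma covariance_ge0 u : 0 <= qform G u.
Proof. by have [_ H _] := normal (Ordinal n0); exact: H. Qed.

Lemma expectation_qform_gram u :
  (\int[P]_w (qform (gram (X w : 'M[R]_(n, p))) u)%:E = (V u)%:E)%E.
Proof.
have mp i : measurable_fun setT (fun w => (proj u (row_vec X i w) ^+ 2)%:E).
  by apply/measurable_EFinP/measurable_funX; exact: measurable_proj_row.
under eq_integral do rewrite qform_gram_rows EFinM -sumEFin.
have c0 : (0 <= (n%:R^-1 : R)%:E)%E by rewrite lee_fin invr_ge0.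
have s0 w : (0 <= \sum_i (proj u (row_vec X i w) ^+ 2)%:E)%E.
  by apply: sume_ge0 => i _; rewrite lee_fin sqr_ge0.
rewrite ge0_integralZl//=; last exact: emeasurable_sum.
rewrite ge0_integral_sum//; last by move=> i w _; rewrite lee_fin sqr_ge0.
under eq_bigr do rewrite (normal_law_sqr (measurable_proj_row u _)
  (covariance_ge0 u) (@proj_row_law u _)).
rewrite sumEFin -EFinM sumr_const card_ord -/(V u) -(mulr_natl (V u) n) mulrA mulVf ?mul1r//.
by rewrite pnatr_eq0 -lt0n.
Qed.

(** Polarization reduces the entries of the Gram matrix to its quadratic forms, whose expectations
    are known and finite; this identifies the inner product matrix as [G + m *m m^T]. *)
Lemma inner_product_matrixE u : qform (inner_product_matrix P (X : T -> 'M[R]_(n, p))) u = V u.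
Proof.
have [sG _ _] := normal (Ordinal n0).
suff -> : inner_product_matrix P (X : T -> 'M[R]_(n, p)) = G + m *m m^T.
  rewrite /qform bformDM addrC; congr (_ + _).
  have -> : bform (m *m m^T) u u = (u^T *m m *m (u^T *m m)^T) 0 0.
    by rewrite /bform trmx_mul trmxK !mulmxA.
  by rewrite mxE big_ord1 [_^T _ _]mxE expr2.
apply/matrixP => j k; rewrite mxE.
pose a : 'cV[R]_p := delta_mx j 0 + delta_mx k 0.
pose b : 'cV[R]_p := delta_mx j 0 - delta_mx k 0.
have E w : gram (X w : 'M[R]_(n, p)) j k =
    4^-1 * (qform (gram (X w : 'M[R]_(n, p))) a - qform (gram (X w : 'M[R]_(n, p))) b).
  by rewrite -bform_delta (bform_polar _ _ (proj1 (psd_gram _))) mulrC.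
have I u' : P.-integrable setT (EFin \o (fun w => qform (gram (X w : 'M[R]_(n, p))) u')).
  apply/integrableP; split; first by apply/measurable_EFinP; exact: measurable_qform_gram.
  under eq_integral do rewrite /= ger0_norm ?(proj2 (psd_gram _))//.
  by rewrite expectation_qform_gram ltry.
rewrite unlock; under eq_integral do rewrite E EFinM EFinB.
rewrite integralZl//; last by apply: integrableB => //; exact: I.
rewrite integralB//; [|exact: I|exact: I].
rewrite !expectation_qform_gram -EFinB -EFinM /=.
have projE v : proj v m = bform 1%:M v m by rewrite /bform mulmx1.
rewrite /V !projE /a /b !qformD /qform !(bformNl, bformNr) !bform_delta.
rewrite !(bformDl, bformNl) !bform_deltal !mul1mx.
rewrite [RHS]mxE [(m *m _) _ _]mxE big_ord1 [m^T _ _]mxE.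
have -> : G k j = G j k by rewrite -[in LHS]sG mxE.
by field.
Qed.

(** The exponent [n (4 t^2 V^2 - t delta V)] is minimal at [t = delta / (8 V)], with value
    [- n delta^2 / 16]; the lower tail takes the opposite [t]. The condition [delta <= 2] ensures
    [t V <= 1 / 4]. *)
Lemma gram_concentration u delta : 0 < V u -> 0 < delta -> delta <= 2 ->
  (P [set w | (delta * V u < `|qform (gram (X w : 'M[R]_(n, p))) u - V u|)%R] <=
   (2 * expR (- (n%:R * delta ^+ 2 / 16)))%:E)%E.
Proof.
move=> V0 d0 d2.
pose S w := \sum_i proj u (row_vec X i w) ^+ 2.
have mS : measurable_fun setT S.
  by apply: measurable_sum => i; apply: measurable_funX; exact: measurable_proj_row.
have nn : 0 < n%:R :> R by rewrite ltr0n.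
have bnd t : t * V u <= 1 / 4 ->
    (\int[P]_w (expR (t * S w))%:E <= (expR (n%:R * (t * V u + 4 * t ^+ 2 * V u ^+ 2)))%:E)%E.
  move=> tV.
  pose f (i : 'I_n) (x : borelM R p 1) := expR (t * proj u x ^+ 2).
  have mf i : measurable_fun setT (f i) by apply: measurable_expR_sqr; exact: measurable_proj.
  have f0 i x : 0 <= f i x by exact: expR_ge0.
  have le i := normal_law_expR_sqr_le (measurable_proj_row u i) (covariance_ge0 u)
     (@proj_row_law u i) tV.
  have ge i : (0 <= \int[P]_w (f i (row_vec X i w))%:E)%E.
    by apply: integral_ge0 => w _; rewrite lee_fin.
  pose c i := fine (\int[P]_w (f i (row_vec X i w))%:E)%E.
  have fc i : (\int[P]_w (f i (row_vec X i w))%:E = (c i)%:E)%E.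
    rewrite /c fineK// ge0_fin_numE//; apply: le_lt_trans (le i) _; exact: ltry.
  have := expectation_prod_indep measurable_row_vec indep mf f0 fc.
  have -> : (\int[P]_w (\prod_i f i (row_vec X i w))%:E =
      \int[P]_w (expR (t * S w))%:E)%E.
    by apply: eq_integral => w _; rewrite /S mulr_sumr expR_sum.
  move=> ->; rewrite lee_fin expRM_natl; set E := expR _.
  have -> : E ^+ n = \prod_(i < n) E by rewrite prodr_const card_ord.
  by apply: ler_prod => i _; rewrite -!lee_fin -fc ge le.
pose tail t := [set w | (t * (n%:R * (V u + 8 * t * V u ^+ 2)) <= t * S w)%R].
have tail_le t : t * V u <= 1 / 4 -> (8 * t * V u) ^+ 2 = delta ^+ 2 ->
    (P (tail t) <= (expR (- (n%:R * delta ^+ 2 / 16)))%:E)%E.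
  move=> tV td; have := le_trans (chernoff P t (n%:R * (V u + 8 * t * V u ^+ 2)) mS) (bnd t tV).
  rewrite -lee_pdivlMr ?expR_gt0// => /le_trans; apply.
  rewrite -EFinM lee_fin -expRN -expRD ler_expR -td; lra.
have mtail t : measurable (tail t).
  by apply: measurable_ge_cst; exact: measurable_funM.
pose t := delta / (8 * V u).
have tV : t * V u = delta / 8 by rewrite /t; field; rewrite gt_eqF.
have t0 : 0 < t by rewrite divr_gt0// mulr_gt0.
apply: (@le_trans _ _ (P (tail t `|` tail (- t)))).
  apply: le_measure; rewrite ?inE.
  - apply: measurable_gt_cst; apply: measurableT_comp => //.
    by apply: measurable_funB => //; exact: measurable_qform_gram.
  - exact: measurableU.
  - move=> w /=; rewrite qform_gram_rows -/(S w) ltr_normr => h.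
    have tVV : 8 * t * V u ^+ 2 = delta * V u by rewrite /t; field; rewrite gt_eqF.
    have nS : n%:R * (n%:R^-1 * S w) = S w by rewrite mulrA divff ?mul1r// gt_eqF.
    case/orP: h => h; [left|right]; rewrite /tail /=.
      by rewrite ler_pM2l// tVV -nS ler_pM2l//; lra.
    by rewrite mulrN !mulNr lerN2 ler_pM2l// tVV -nS ler_pM2l//; lra.
apply: le_trans (measureU2 _ _ _) _ => //.
rewrite mulr_natl mulr2n EFinD; apply: leeD; apply: tail_le; rewrite ?mulrN ?mulNr ?sqrrN.
- by rewrite tV; lra.
- by rewrite -mulrA tV mulrC divfK.
- by rewrite tV; lra.
- by rewrite -mulrA tV mulrC divfK.
Qed.

End gaussian_design.

(** * The noise and the conditional law *)

Section joint_law.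
Local Open Scope ereal_scope.
Context {R : realType} d d1 d2 (T : measurableType d) (T1 : measurableType d1)
  (T2 : measurableType d2) (P : probability T R).
Context (X : {RV P >-> T1}) (E : {RV P >-> T2}).
Context (indep : independent2 P E X).

Lemma integral_independent2 (h : T1 * T2 -> \bar R) :
  measurable_fun setT h -> (forall z, 0 <= h z) ->
  \int[P]_w h (X w, E w) =
  \int[distribution P X]_x \int[distribution P E]_e h (x, e).
Proof.
move=> mh h0.
have mXE : measurable_fun setT (fun w => (X w, E w)) by exact: measurable_fun_pair.
pose XE : {mfun T >-> (T1 * T2)%type} := HB.pack (fun w => (X w, E w))
  (isMeasurableFun.Build _ _ _ _ _ mXE).
transitivity (\int[distribution P XE]_z h z).
  by rewrite ge0_integral_distribution.
rewrite (eq_measure_integral (distribution P X \x distribution P E)); last first.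
  move=> A mA _; apply/esym/product_measure_unique => // B C mB mC.
  rewrite muleC -[RHS]indep//; congr (P _).
  by apply/seteqP; split=> w /= [].
exact: fubini_tonelli1.
Qed.

End joint_law.

Section section_kernel.
Context {R : realType} d1 d2 d3 (T1 : measurableType d1) (T2 : measurableType d2)
  (T3 : measurableType d3) (mu : probability T2 R).
Context (F : T1 * T2 -> T3) (mF : measurable_fun setT F).

Let msection x : measurable_fun setT (fun e => F (x, e)).
Proof. by apply: measurableT_comp => //; exact: pair1_measurable. Qed.

Let sect x : {mfun T2 >-> T3} :=
  HB.pack (fun e => F (x, e)) (isMeasurableFun.Build _ _ _ _ _ (msection x)).

(** The law of [F (x, e)] for [e] distributed as [mu]. If [e] is independent of a variable [X], this
    is a regular conditional distribution of [F (X, e)] given [X]. *)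
Definition section_kernel (x : T1) : {measure set T3 -> \bar R} :=
  distribution mu (sect x).

Let measurable_section_kernel U :
  measurable U -> measurable_fun setT (section_kernel ^~ U).
Proof.
move=> mU; have mA : measurable (F @^-1` U) by rewrite -[X in measurable X]setTI; exact: mF.
have := measurable_fun_xsection mu mA.
by congr (measurable_fun _ _); apply/funext => x /=; congr (mu _); apply/seteqP; split=> e;
  rewrite /xsection/= inE.
Qed.

HB.instance Definition _ := isKernel.Build _ _ _ _ _ section_kernel measurable_section_kernel.

Let section_kernel_setT x : section_kernel x setT = 1%E.
Proof. exact: probability_setT. Qed.

HB.instance Definition _ := Kernel_isProbability.Build _ _ _ _ _ section_kernel section_kernel_setT.

End section_kernel.

Section gaussian_noise.
Context {R : realType} d (T : measurableType d) (P : probability T R) (n p : nat).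
Context (X : {RV P >-> borelM R n p}) (eps : {RV P >-> borelM R n 1}) (sig2 : R).
Context (indep : independent2 P eps X).
Context (normal : mvnormal (distribution P eps) 0 (sig2%:M)).

Lemma noise_proj_law (u : 'cV[R]_n) A : measurable A ->
  distribution P eps [set e | A ((u^T *m (e : 'cV[R]_n)) 0 0)] =
  normal_law 0 (sig2 * sqnorm2 u) A.
Proof.
move=> mA; have [_ _ H] := normal; rewrite (H u A mA) mulmx0 mxE; congr normal_law.
by rewrite mul_mx_scalar -scalemxAl mxE sqnorm2E.
Qed.

Lemma noise_var_ge0 (u : 'cV[R]_n) : 0 <= sig2 * sqnorm2 u.
Proof.
have [_ H _] := normal; have := H u.
by rewrite mul_mx_scalar -scalemxAl mxE sqnorm2E.
Qed.

(** The kernel is the law of [B x *m e] with [x] frozen: independence and Fubini make it a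
    conditional distribution, and its projections are projections of the noise onto
    [(B x)^T *m a]. *)
Lemma cond_centered_normal_linear (B : 'M[R]_(n, p) -> 'M[R]_(p, n))
    (S : 'M[R]_(n, p) -> 'M[R]_p) (W : {RV P >-> borelM R p 1}) :
  (forall i j, measurable_fun setT (fun x : borelM R n p => B x i j)) ->
  (forall w, W w = B (X w) *m (eps w : 'cV[R]_n)) ->
  (forall x, S x = sig2 *: (B x *m (B x)^T)) ->
  cond_centered_normal W X S.
Proof.
move=> mB WE SE.
pose F (z : borelM R n p * borelM R n 1) : borelM R p 1 := B z.1 *m (z.2 : 'cV[R]_n).
have mF : measurable_fun setT F.
  apply: measurable_borelM; apply: measurable_mulmx => i j.
    exact: (measurableT_comp (mB i j) measurable_fst).
  exact: (measurableT_comp (measurable_coord i j) measurable_snd).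
exists (section_kernel (distribution P eps) mF); split.
  move=> A C mA mC.
  have mC' : measurable (F @^-1` C) by rewrite -[X in measurable X]setTI; exact: mF.
  pose h (z : borelM R n p * borelM R n 1) : \bar R := (\1_(A `*` setT `&` F @^-1` C) z)%:E.
  have mD : measurable (A `*` setT `&` F @^-1` C).
    by apply: measurableI => //; exact: measurableX.
  have mh : measurable_fun setT h by apply/measurable_EFinP; exact: measurable_indic.
  have h0 z : (0 <= h z)%E by rewrite lee_fin.
  transitivity (\int[P]_w h (X w, eps w))%E.
    have -> : X @^-1` A `&` W @^-1` C =
        (fun w => (X w, eps w)) @^-1` (A `*` setT `&` F @^-1` C).
      apply/seteqP; split=> w /=; rewrite /F /= WE; first by case.
      by case=> -[].
    rewrite -[X in P X]setIT -integral_indic//; last first.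
      rewrite -[X in measurable X]setTI.
      by apply: (measurable_fun_pair (f := X) (g := eps)).
  rewrite (integral_independent2 indep mh h0) [RHS]integral_mkcond.
  apply: eq_integral => x _; rewrite patchE.
  have mCx : measurable [set e | C (F (x, e))].
    have mFx : measurable_fun setT (fun e => F (x, e)).
      by apply: measurableT_comp => //; exact: pair1_measurable.
    by rewrite -[X in measurable X]setTI; exact: mFx.
  have [Ax|xA] := pselect (A x).
    rewrite mem_set// (eq_integral (fun e => (\1_[set e | C (F (x, e))] e)%:E)).
      by rewrite integral_indic// setIT.
    move=> e _; rewrite /h !indicE; congr (((_ : bool)%:R)%:E).
    by apply/idP/idP; rewrite !inE /=; [case|split].
  rewrite memNset//; apply: integral0_eq => e _; rewrite /h indicE memNset//=.
  by case=> -[].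
move=> x; split; rewrite ?SE.
- by rewrite linearZ/= trmx_mul trmxK.
- move=> a; rewrite -scalemxAr -scalemxAl mxE.
  have -> : (a^T *m (B x *m (B x)^T) *m a) 0 0 = sqnorm2 ((B x)^T *m a).
    by rewrite sqnorm2E trmx_mul trmxK !mulmxA.
  exact: noise_var_ge0.
- move=> a A mA; rewrite mulmx0 [(0 : 'M[R]_(_, _)) 0 0]mxE.
  rewrite -[a^T *m (sig2 *: _)]scalemxAr -[sig2 *: _ *m a]scalemxAl [X in normal_law _ X]mxE.
  have -> : (a^T *m (B x *m (B x)^T) *m a) 0 0 = sqnorm2 ((B x)^T *m a).
    by rewrite sqnorm2E trmx_mul trmxK !mulmxA.
  rewrite -noise_proj_law//; congr (P _); apply/seteqP; split=> w /=.
    by rewrite trmx_mul trmxK mulmxA.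
  by rewrite trmx_mul trmxK mulmxA.
Qed.

Lemma gram_diagE (x : 'M[R]_(n, p)) k : gram x k k = sqnorm2 (col k x) / n%:R.
Proof. by rewrite -bform_delta -/(qform _ _) qform_gram -colE. Qed.

(** Exponential Markov for the square of a Gaussian of variance [v <= s B / n], which covers both
    tails. At [t = n / (4 s B)] one has [t v <= 1 / 4], so [t v + 4 (t v)^2 <= 1 / 2]. *)
Lemma noise_tail (x : 'M[R]_(n, p)) k (C B s : R) :
  (0 < n)%N -> 0 <= C -> 0 < B -> 0 < s -> sig2 <= s -> gram x k k <= B ->
  (distribution P eps [set e | (C < `|(n%:R^-1 *: (x^T *m (e : 'cV[R]_n))) k 0|)%R] <=
   (expR (1 / 2 - C ^+ 2 * n%:R / (4 * (s * B))))%:E)%E.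
Proof.
move=> n0 C0 B0 s0 sig2s gB.
have nn : 0 < n%:R :> R by rewrite ltr0n.
pose u := n%:R^-1 *: col k x.
pose Z (e : borelM R n 1) := (u^T *m (e : 'cV[R]_n)) 0 0.
have mZ : measurable_fun setT Z.
  by apply: measurable_mulmx => i j; [exact: measurable_cst|exact: measurable_coord].
have ZE e : Z e = (n%:R^-1 *: (x^T *m (e : 'cV[R]_n))) k 0.
  rewrite /Z /u linearZ/= -scalemxAl !mxE; congr (_ * _).
  by apply: eq_bigr => i _; rewrite !mxE.
have -> : [set e : borelM R n 1 | (C < `|(n%:R^-1 *: (x^T *m (e : 'cV[R]_n))) k 0|)%R] =
   [set e | (C < `|Z e|)%R] by apply/seteqP; split=> e /=; rewrite ZE.
pose v := sig2 * sqnorm2 u.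
have v0 : 0 <= v by exact: noise_var_ge0.
have ug : sqnorm2 u = gram x k k / n%:R.
  rewrite gram_diagE -!qform1 qformZ; field; exact: lt0r_neq0.
have vs : v <= s * B / n%:R.
  rewrite /v ug -mulrA.
  have g0 : 0 <= gram x k k / n%:R by rewrite -ug sqnorm2_ge0.
  apply: (@le_trans _ _ (s * (gram x k k / n%:R))); first exact: ler_wpM2r.
  by rewrite ler_pM2l// ler_pM2r// invr_gt0.
pose t := n%:R / (4 * (s * B)).
have t0 : 0 < t by rewrite divr_gt0// !mulr_gt0.
have tv : t * v <= 1 / 4.
  apply: (@le_trans _ _ (t * (s * B / n%:R))); first by rewrite ler_pM2l.
  by rewrite le_eqVlt; apply/orP; left; apply/eqP; rewrite /t; field; rewrite !gt_eqF.
have mgf := normal_law_expR_sqr_le (P := distribution P eps) mZ v0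
   (fun A mA => @noise_proj_law u A mA) (t := t).
rewrite expr0n/= add0r in mgf.
have mZ2 : measurable_fun setT (fun e => Z e ^+ 2) by exact: measurable_funX.
have := le_trans (chernoff (distribution P eps) t (C ^+ 2) mZ2) (mgf tv).
rewrite -lee_pdivlMr ?expR_gt0// -EFinM -expRN -expRD => H.
apply: (@le_trans _ _ (distribution P eps [set e | (t * C ^+ 2 <= t * Z e ^+ 2)%R])).
  apply: le_measure; rewrite ?inE.
  - by apply: measurable_gt_cst; exact: measurableT_comp.
  - by apply: measurable_ge_cst; exact: measurable_funM.
  - move=> e /= Ce; rewrite ler_pM2l// -[Z e ^+ 2]real_normK ?num_real//.
    by rewrite ler_pXn2r ?nnegrE// ltW.
apply: (le_trans H); rewrite lee_fin ler_expR.
have tv0 : 0 <= t * v by rewrite mulr_ge0// ltW.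
have : (t * v) ^+ 2 <= t * v * (1 / 4) by rewrite expr2 ler_wpM2l.
have -> : C ^+ 2 * n%:R / (4 * (s * B)) = t * C ^+ 2.
  by rewrite /t; field; rewrite !gt_eqF.
by lra.
Qed.

(** The noise bound given the design depends on the length of column [k]. Intersecting with a bound
    on that length lets one estimate hold for every design in the outer integral. *)
Definition noise_event k (C B : R) : set T :=
  [set w | C < `|(n%:R^-1 *: ((X w : 'M[R]_(n, p))^T *m (eps w : 'cV[R]_n))) k 0|
     /\ gram (X w : 'M[R]_(n, p)) k k <= B].

Lemma noise_design_tail k (C B s : R) :
  (0 < n)%N -> 0 <= C -> 0 < B -> 0 < s -> sig2 <= s ->
  measurable (noise_event k C B) /\
  (P (noise_event k C B) <= (expR (1 / 2 - C ^+ 2 * n%:R / (4 * (s * B))))%:E)%E.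
Proof.
move=> n0 C0 B0 s0 sig2s; set D := noise_event k C B.
pose D' : set (borelM R n p * borelM R n 1) :=
  [set z | (C < `|(n%:R^-1 *: ((z.1 : 'M[R]_(n, p))^T *m (z.2 : 'cV[R]_n))) k 0|)%R
                 /\ (gram (z.1 : 'M[R]_(n, p)) k k <= B)%R].
have m1 i j : measurable_fun setT
    (fun z : borelM R n p * borelM R n 1 => (z.1 : 'M[R]_(n, p)) i j).
  exact: (measurableT_comp (measurable_coord i j) measurable_fst).
have m2 i j : measurable_fun setT
    (fun z : borelM R n p * borelM R n 1 => (z.2 : 'cV[R]_n) i j).
  exact: (measurableT_comp (measurable_coord i j) measurable_snd).
have m1T i j : measurable_fun setT
    (fun z : borelM R n p * borelM R n 1 => (z.1 : 'M[R]_(n, p))^T i j).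
  by under eq_fun do rewrite mxE; exact: m1.
have mD' : measurable D'.
  apply: measurableI.
    apply: measurable_gt_cst; apply: measurableT_comp => //; under eq_fun do rewrite mxE.
    by apply: measurable_funM => //; exact: measurable_mulmx.
  apply: measurable_le_cst; rewrite /gram; under eq_fun do rewrite mxE.
  by apply: measurable_funM => //; exact: measurable_mulmx.
have mXE : measurable_fun setT (fun w => (X w, eps w)) by exact: measurable_fun_pair.
have DE : D = (fun w => (X w, eps w)) @^-1` D' by [].
have mD : measurable D by rewrite DE -[X in measurable X]setTI; exact: mXE.
split => //.
pose h z : \bar R := (\1_D' z)%:E.
have mh : measurable_fun setT h by apply/measurable_EFinP; exact: measurable_indic.
have h0 z : (0 <= h z)%E by rewrite lee_fin.
have -> : P D = (\int[P]_w h (X w, eps w))%E.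
  by rewrite -[X in P X]setIT -integral_indic.
rewrite (integral_independent2 indep mh h0).
set b := (expR _)%:E.
have b0 : (0 <= b)%E by rewrite lee_fin expR_ge0.
apply: (@le_trans _ _ (\int[distribution P X]_x cst b x)%E); last first.
  by rewrite integral_cst// -[X in (_ <= X)%E]mule1 lee_wpmul2l// probability_le1.
apply: ge0_le_integral => //.
- by move=> x _; exact: integral_ge0.
- apply: measurable_fun_fubini_tonelli_F => //.
move=> x _ /=.
have [gB|gB] := leP (gram (x : 'M[R]_(n, p)) k k) B; last first.
  by rewrite integral0_eq// => e _; rewrite /h indicE memNset// => -[] /= _; rewrite leNgt gB.
apply: le_trans (@noise_tail x k C B s n0 C0 B0 s0 sig2s gB).
set E : set (borelM R n 1) := [set e | _].
have mE : measurable E.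
  have mxe : measurable_fun setT (fun e : borelM R n 1 => (x, e)) by exact: pair1_measurable.
  have -> : E = (fun e => (x, e)) @^-1` D' by apply/seteqP; split=> [e Ee|e []].
  by rewrite -[X in measurable X]setTI; exact: mxe.
rewrite (eq_integral (fun e => (\1_E e)%:E)); last first.
  move=> e _; rewrite /h !indicE; congr (((_ : bool)%:R)%:E).
  by apply/idP/idP; rewrite !inE /=; [case|move=> Ee; split].
by rewrite integral_indic// setIT.
Qed.

End gaussian_noise.

(** * The good event *)

Section good_event.
Context {R : realType} d (T : measurableType d) (P : probability T R) (n p : nat).
Context (X : {RV P >-> borelM R n p}) (eps : {RV P >-> borelM R n 1}) (sig2 : R).
Context (indep : independent2 P eps X).
Context (normal : mvnormal (distribution P eps) 0 (sig2%:M)).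
Context (rows : iid_gaussian_rows X) (n0 : (0 < n)%N).
Context (S : 'M[R]_p) (SE : S = inner_product_matrix P (X : T -> 'M[R]_(n, p))).
Context (l K s delta C : R) (k : nat).
Context (l0 : 0 < l) (Sl : forall u, l * sqnorm2 u <= qform S u).
Context (K0 : 0 < K) (SK : forall j, S j j <= K).
Context (s0 : 0 < s) (sig2s : sig2 <= s).
Context (d0 : 0 < delta) (d2 : delta <= 2) (C0 : 0 <= C) (k1 : (1 < k)%N).

Let Th := invmx S.
Let th j := col j Th.
Let Sh w := gram (X w : 'M[R]_(n, p)).

Lemma inner_product_matrix_sym : S^T = S.
Proof.
rewrite SE; apply/matrixP => i j; rewrite !mxE; congr fine; congr expectation.
apply/funext => w; have /matrixP/(_ i j) := proj1 (psd_gram (X w : 'M[R]_(n, p))).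
by rewrite mxE.
Qed.

Lemma posdef_unitmx : S \in unitmx.
Proof.
rewrite -row_free_unit -kermx_eq0; apply/negPn/negP => /rowV0Pn[v /sub_kermxP vS v0].
have := Sl v^T; rewrite /qform /bform trmxK vS mul0mx mxE.
rewrite pmulr_rle0// => sq0; move/eqP: v0; apply.
have : qform 1%:M v^T = 0 by apply/eqP; rewrite eq_le (proj2 (psd1 p)) qform1 sq0.
move/(qform_eq0_kernel (psd1 p)); rewrite mul1mx => /(congr1 trmx).
by rewrite trmxK trmx0.
Qed.

Let STh : S *m Th = 1%:M.
Proof. exact: mulmxV posdef_unitmx. Qed.

Lemma qform_posdef u : u != 0 -> 0 < qform S u.
Proof.
move=> u0; apply: lt_le_trans (Sl u); rewrite mulr_gt0// lt_neqAle sqnorm2_ge0 andbT.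
rewrite eq_sym; apply: contra u0 => /eqP u0.
by have := qform_eq0_kernel (psd1 p) (etrans (qform1 u) u0); rewrite mul1mx => ->.
Qed.

Lemma gram_deviation u (D : R) : 0 < D -> D <= 2 ->
  let A := [set w | D * qform S u < `|qform (Sh w) u - qform S u|] in
  measurable A /\ (P A <= (2 * expR (- (n%:R * D ^+ 2 / 16)))%:E)%E.
Proof.
move=> D0 D2 A; case: rows => ind [m [G law]].
split.
  apply: measurable_gt_cst; apply: measurableT_comp => //.
  by apply: measurable_funB => //; exact: measurable_qform_gram.
have [u0|u0] := eqVneq u 0.
  rewrite (_ : A = set0) ?measure0 ?lee_fin ?mulr_ge0 ?expR_ge0//.
  by apply/seteqP; split=> w //=; rewrite /A /= u0 /qform !bform0l mulr0 subrr normr0 ltxx.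
have VE : qform S u = (u^T *m m) 0 0 ^+ 2 + qform G u.
  by rewrite SE; exact: inner_product_matrixE.
rewrite /A VE; apply: gram_concentration => //.
by rewrite -VE; exact: qform_posdef.
Qed.

(** Pairing a unit vector with a column of [Th] controls [Sh *m Th], two columns control the form in
    [H2], and two equal unit vectors the diagonal of [Sh]. *)
Definition node_vector (a : bool * 'I_p) : 'cV[R]_p :=
  if a.1 then th a.2 else delta_mx a.2 0.

Let pm (c : bool) (u v : 'cV[R]_p) := if c then u + v else u - v.

Let bad1 (i : (bool * 'I_p) * (bool * 'I_p) * bool) : set T :=
  [set w | delta * qform S (pm i.2 (node_vector i.1.1) (node_vector i.1.2)) <
    `|qform (Sh w) (pm i.2 (node_vector i.1.1) (node_vector i.1.2)) -
      qform S (pm i.2 (node_vector i.1.1) (node_vector i.1.2))|].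

Let atoms (q : k.-tuple (bool * 'I_p)) : 'cV[R]_p := \sum_(a <- q) signed_atom a.

(** Relative deviation 1 / 2 is what [restricted_eigenvalue] asks for, and by [gram_deviation] it
    yields the exponent [n / 64]. *)
Let bad2 (q : k.-tuple (bool * 'I_p)) : set T :=
  [set w | 1 / 2 * qform S (atoms q) < `|qform (Sh w) (atoms q) - qform S (atoms q)|].

Let bad3 (j : 'I_p) := noise_event X eps j C (2 * K).

Lemma measure_finType_union (I : finType) (F : I -> set T) (b : R) :
  (forall i, measurable (F i) /\ (P (F i) <= b%:E)%E) ->
  measurable (\big[setU/set0]_i F i) /\
  (P (\big[setU/set0]_i F i) <= (#|I|%:R * b)%:E)%E.
Proof.
move=> H; rewrite cardE -big_enum/=.
elim: (enum I) => [|i r [mF PF]]; first by rewrite !big_nil measure0 mul0r.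
rewrite big_cons; have [mi Pi] := H i; split; first exact: measurableU.
apply: le_trans (measureU2 _ _ _) _ => //.
by rewrite /= -[(size r).+1]add1n natrD mulrDl mul1r EFinD leeD.
Qed.

(* The three summands bound the deviations of [Sh] on the vectors [a + b] and [a - b]
   for columns [a], [b] of the identity and of [Th], on sums of [k] signed atoms, and
   the correlation of the noise with the design. *)
Lemma good_event : exists Bad : set T,
  [/\ measurable Bad,
      (P Bad <= (16 * p%:R ^+ 2 * expR (- (n%:R * delta ^+ 2 / 16)) +
                 (2 * p%:R) ^+ k * (2 * expR (- (n%:R / 64))) +
                 p%:R * expR (1 / 2 - C ^+ 2 * n%:R / (4 * (s * (2 * K)))))%:E)%E &
      forall w, ~ Bad w -> let om := delta * (K + l^-1) in
      [/\ forall i j, `|(Sh w *m Th) j i - (j == i)%:R| <= om,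
          forall i j, `|bform (Sh w) (th i) (th j) - Th i j| <= om,
          forall j, Sh w j j <= K + om,
          forall v, (forall j, Sh w j j <= 2 * K) ->
            l / 2 * sqnorm2 v - 2 * K / (k%:R - 1) * norm1 v ^+ 2 <= qform (Sh w) v &
          forall j, Sh w j j <= 2 * K ->
            `|(n%:R^-1 *: ((X w : 'M[R]_(n, p))^T *m (eps w : 'cV[R]_n))) j 0| <= C]].
Proof.
have sS := inner_product_matrix_sym.
have [mB1 PB1] := @measure_finType_union _ bad1 _
  (fun i => gram_deviation (pm i.2 (node_vector i.1.1) (node_vector i.1.2)) d0 d2).
have h1 : 0 < 1 / 2 :> R by [].
have h2 : 1 / 2 <= 2 :> R by lra.
have [mB2 PB2] := @measure_finType_union _ bad2 _ (fun q => gram_deviation (atoms q) h1 h2).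
have [mB3 PB3] := @measure_finType_union _ bad3 _
  (fun j => noise_design_tail indep normal j n0 C0 (mulr_gt0 (ltr0n _ 2) K0) s0 sig2s).
set B1 := \big[setU/set0]_i bad1 i in mB1 PB1.
set B2 := \big[setU/set0]_i bad2 i in mB2 PB2.
set B3 := \big[setU/set0]_i bad3 i in mB3 PB3.
exists (B1 `|` B2 `|` B3); split.
- by apply: measurableU => //; exact: measurableU.
- apply: le_trans (measureU2 _ _ _) _ => //; first exact: measurableU.
  rewrite EFinD; apply: leeD; last first.
    by apply: le_trans PB3 _; rewrite card_ord.
  apply: le_trans (measureU2 _ _ _) _ => //; rewrite EFinD; apply: leeD.
    apply: le_trans PB1 _; rewrite !card_prod !card_bool card_ord lee_fin.
    by rewrite le_eqVlt; apply/orP; left; apply/eqP; rewrite !natrM; ring.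
  apply: le_trans PB2 _; rewrite card_tuple card_prod card_bool card_ord lee_fin.
  rewrite natrX natrM le_eqVlt; apply/orP; left; apply/eqP; congr (_ * (_ * expR _)).
  by field.
move=> w nB om.
have G1 i : ~ bad1 i w by move=> b; apply: nB; do 2 left; rewrite /B1 (bigD1 i)//=; left.
have G2 i : ~ bad2 i w by move=> b; apply: nB; left; right; rewrite /B2 (bigD1 i)//=; left.
have G3 i : ~ bad3 i w by move=> b; apply: nB; right; rewrite /B3 (bigD1 i)//=; left.
have pS : psd S by split=> // u; apply: le_trans (Sl u); rewrite mulr_ge0 ?sqnorm2_ge0// ltW.
have nvle a : qform S (node_vector a) <= K + l^-1.
  rewrite /node_vector; case: a => [[] j] /=; last first.
    by rewrite /qform bform_delta; have := SK j; have : 0 < l^-1 by [rewrite invr_gt0]; lra.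
  rewrite /qform (bformS_th STh) mxE.
  have [/andP[Tl _] T0] := precision_diag_bounds sS STh l0 Sl SK j.
  have : Th j j <= l^-1 by rewrite -[leLHS]invrK lef_pV2 ?posrE ?invr_gt0.
  by have := K0; lra.
(* By polarization the error is a quarter of those at [a + b] and [a - b]. These are relative to the
   values of [S] there, which by the parallelogram law sum to at most [4 * (K + l^-1)]. *)
have close a b : `|bform (Sh w) (node_vector a) (node_vector b) -
     bform S (node_vector a) (node_vector b)| <= om.
  have := G1 (a, b, true); have := G1 (a, b, false); rewrite /bad1 /pm /=.
  move=> /negP; rewrite -leNgt => e1 /negP; rewrite -leNgt => e2.
  rewrite !bform_polar//; last exact: (proj1 (psd_gram _)).
  have par : qform S (node_vector a + node_vector b) + qform S (node_vector a - node_vector b) =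
     2 * qform S (node_vector a) + 2 * qform S (node_vector b).
    by rewrite !qformD /qform !(bformNl, bformNr); ring.
  have ka := nvle a; have kb := nvle b.
  have : delta * (2 * qform S (node_vector a) + 2 * qform S (node_vector b)) <= 4 * om.
    by rewrite /om mulrCA ler_pM2l//; lra.
  rewrite -par; move: e1 e2; rewrite !ler_norml => /andP[a1 a2] /andP[b1 b2] h.
  by apply/andP; split; lra.
split.
- move=> i j; have := close (false, j) (true, i); rewrite /node_vector /=.
  rewrite !bform_deltal.
  have E (M : 'M[R]_p) : (M *m th i) j 0 = (M *m Th) j i.
    by rewrite /th colE mulmxA -colE mxE.
  by rewrite !E STh [1%:M _ _]mxE.
- move=> i j; have := close (true, i) (true, j); rewrite /node_vector /=.
  have -> : Th i j = Th j i by rewrite -[in LHS](precision_sym sS STh) mxE.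
  by rewrite (bformS_th STh) mxE.
- move=> j; have := close (false, j) (false, j); rewrite /node_vector /= !bform_delta.
  by rewrite ler_norml => /andP[_]; have := SK j; lra.
- move=> v ShK.
  have := @restricted_eigenvalue R p S (Sh w) (2 * K) k k1 pS ShK.
  move=> /(_ _ v) H; apply: le_trans (H _); last first.
    move=> q qk; have := G2 (tcast qk (in_tuple q)); rewrite /bad2 /atoms /=.
    rewrite val_tcast/= => /negP; rewrite -leNgt ler_norml => /andP[]; lra.
  by have := Sl v; lra.
- move=> j ShK; rewrite leNgt; apply/negP => h; apply: (G3 j); by split.
Qed.

End good_event.

(** * Error of the estimators at a fixed sample size *)

Section desparsified_error.
Context {R : realType}.

(** These three restate [psi], [chi2] and the bound of [Omega_close] as functions of [om] and [q2],
    so that limits can be taken. *)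
Definition tau2_error (K om q2 : R) := K * om + Num.sqrt (2 * K * q2).

Definition Theta_error (K l om q2 : R) :=
  8 * q2 / l ^+ 2 + 8 * tau2_error K om q2 ^+ 2 / l ^+ 2 * (l^-1 + om).

Definition Omega_error (K l om q2 : R) :=
  om + 2 * Num.sqrt (Theta_error K l om q2 * (l^-1 + om)) + Theta_error K l om q2.

Lemma desparsified_decomposition n p (Theta : 'M[R]_p) (X : 'M[R]_(n, p)) b0 b e :
  desparsified Theta (X *m b0 + e) X b - b0 - n%:R^-1 *: (Theta *m X^T *m e) =
  - ((Theta *m gram X - 1%:M) *m (b - b0)).
Proof.
rewrite /desparsified /gram -!scalemxAr.
have -> : X *m b0 + e - X *m b = e - X *m (b - b0).
  by rewrite mulmxBr opprB addrAC [RHS]addrA addrC addrA.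
rewrite mulmxBr scalerBr mulmxBl mul1mx opprB -scalemxAl !mulmxA.
set u := _ *: (_ *m e); set v := _ *: (_ *m (b - b0)).
by move: u v => u v; apply/colP => i; rewrite !mxE; ring.
Qed.

Lemma norm_mulmx_le m n (M : 'M[R]_(m, n)) (v : 'cV[R]_n) a :
  (forall i j, `|M i j| <= a) -> forall i, `|(M *m v) i 0| <= a * norm1 v.
Proof.
move=> H i; rewrite mxE; apply: (le_trans (ler_norm_sum _ _ _)).
rewrite /norm1 mulr_sumr; apply: ler_sum => j _; rewrite normrM.
exact: ler_wpM2r.
Qed.

End desparsified_error.

Section fixed_sample_size.
Context {R : realType} d (T : measurableType d) (P : probability T R) (n p : nat).
Context (X : {RV P >-> borelM R n p}) (eps : {RV P >-> borelM R n 1}) (sig2 : R).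
Context (beta0 : 'cV[R]_p) (S : 'M[R]_p) (l K s delta la rho s0 : R) (k : nat).
Context (bh : T -> 'cV[R]_p) (gh : T -> 'I_p -> 'cV[R]_p.-1) (lamj : 'I_p -> R).

Let om := delta * (K + l^-1).
Let q2 := 64 * la ^+ 2 * s0 / l.
Let Th := invmx S.
Let x w := X w : 'M[R]_(n, p).
Let e w := eps w : 'cV[R]_n.
Let Theta w := Theta_lasso lamj (x w) (gh w).

Lemma fixed_sample_bounds :
  independent2 P eps X ->
  mvnormal (distribution P eps) 0 (sig2%:M) ->
  iid_gaussian_rows X -> (0 < n)%N ->
  S = inner_product_matrix P (X : T -> 'M[R]_(n, p)) ->
  0 < l -> (forall u, l * sqnorm2 u <= qform S u) ->
  0 < K -> (forall j, S j j <= K) ->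
  0 < s -> sig2 <= s -> 0 < delta -> delta <= 2 -> (1 < k)%N ->
  0 < la -> 2 * K * om <= la -> om <= K -> 0 <= rho -> 2 * K / (k%:R - 1) <= rho ->
  (forall j, lamj j = la) ->
  (forall w, is_lasso la (x w *m beta0 + e w) (x w) (bh w)) ->
  (forall w j, is_nodewise_lasso (lamj j) (x w) j (gh w j)) ->
  (forall j, (row_sparsity Th j)%:R <= s0) -> 16 * rho * s0 <= l / 4 ->
  16 * rho * (sparsity beta0)%:R <= l / 4 ->
  tau2_error K om q2 <= l / 2 ->
  exists Bad : set T,
  [/\ measurable Bad,
      (P Bad <= (16 * p%:R ^+ 2 * expR (- (n%:R * delta ^+ 2 / 16)) +
                 (2 * p%:R) ^+ k * (2 * expR (- (n%:R / 64))) +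
                 p%:R * expR (1 / 2 - (la / 2) ^+ 2 * n%:R / (4 * (s * (2 * K)))))%:E)%E,
      forall w, ~ Bad w -> forall j,
        `|(Num.sqrt n%:R *: (desparsified (Theta w) (x w *m beta0 + e w) (x w) (bh w) - beta0)
           - Num.sqrt n%:R *: (n%:R^-1 *: (Theta w *m (x w)^T *m e w))) j 0| <=
        32 * la ^+ 2 / l ^+ 2 * (Num.sqrt n%:R * (sparsity beta0)%:R) &
      forall w, ~ Bad w -> forall i j,
        `|(Omega_hat (Theta w) (x w) - Th) i j| <= Omega_error K l om q2].
Proof.
move=> indep normal rows n0 SE l0 Sl K0 SK s00 sig2s d0 d2 k1 la0 laE omK rho0 rhoE lamE.
move=> Hb Hg Hs rs rs0 psil.
have C0 : 0 <= la / 2 by rewrite divr_ge0// ltW.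
have [Bad [mB PB G]] := good_event indep normal rows n0 SE l0 Sl K0 SK s00 sig2s d0 d2 C0 k1.
have sS := inner_product_matrix_sym SE.
have STh : S *m Th = 1%:M by exact: mulmxV (posdef_unitmx l0 Sl).
have om0 : 0 <= om by rewrite mulr_ge0 ?ltW// addr_gt0// invr_gt0.
exists Bad; split => // w /G [H1 H2 H3 H4 H5].
  have ShK j : gram (x w) j j <= 2 * K.
    by apply: le_trans (H3 j) _; rewrite [leRHS]mulr_natl mulr2n lerD2l.
  have RE v : l / 2 * sqnorm2 v - rho * norm1 v ^+ 2 <= qform (gram (x w)) v.
    apply: le_trans (H4 v ShK); rewrite lerD2l lerN2.
    by rewrite ler_wpM2r// sqr_ge0.
  have l2 : 0 < l / 2 by rewrite divr_gt0.
  have rs0' : 16 * rho * (sparsity beta0)%:R <= l / 2 / 2 by apply: le_trans rs0 _; lra.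
  have [|_ N1] := lasso_oracle la0 l2 rho0 (Hb w) _ RE rs0'.
    by move=> j; exact: (H5 j (ShK j)).
  move=> j; rewrite -scalerBr desparsified_decomposition scalerN mxE normrN mxE normrM.
  rewrite ger0_norm ?sqrtr_ge0//.
  have TG := Theta_gram_close sS STh l0 Sl SK rho0 H1 ShK RE la0 laE lamE (Hg w) Hs rs psil.
  have h := norm_mulmx_le (bh w - beta0) TG j.
  (* The entrywise bound of [Theta_gram_close] times the l1 bound of [lasso_oracle] at
     [kap = l / 2]. *)
  rewrite [leRHS](_ : _ = Num.sqrt n%:R * (2 * la / l * (8 * la * (sparsity beta0)%:R / (l / 2)))).
    apply: ler_wpM2l; first exact: sqrtr_ge0.
    apply: le_trans h _; apply: ler_wpM2l => //.
    by rewrite divr_ge0 ?mulr_ge0// ltW.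
  by field; rewrite gt_eqF.
have ShK j : gram (x w) j j <= 2 * K.
    by apply: le_trans (H3 j) _; rewrite [leRHS]mulr_natl mulr2n lerD2l.
have RE v : l / 2 * sqnorm2 v - rho * norm1 v ^+ 2 <= qform (gram (x w)) v.
  apply: le_trans (H4 v ShK); rewrite lerD2l lerN2.
  by rewrite ler_wpM2r// sqr_ge0.
exact: (Omega_close sS STh l0 Sl SK rho0 H1 H2 ShK RE la0 laE lamE (Hg w) Hs rs psil).
Qed.

End fixed_sample_size.

(** * Convergence in probability from bounds off a small event *)

Section convergence_in_probability.
Context {R : realType}.

Lemma norm_gt_entry m n (M : 'M[R]_(m, n)) (a : R) :
  0 <= a -> a < `|M| -> exists i j, a < `|M i j|.
Proof.
move=> a0 aM; have : mx_norm M != 0 by rewrite gt_eqF// (le_lt_trans a0).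
move=> /mx_norm_neq0[[i j] E]; exists i, j.
by rewrite (lt_le_trans aM)// [leLHS]E.
Qed.

Lemma norm_entry_le m n (M : 'M[R]_(m, n)) i j : `|M i j| <= `|M|.
Proof.
have -> : `|M| = mx_norm M by [].
rewrite mx_normrE.
exact: (le_bigmax _ (fun ij : 'I_m * 'I_n => `|M ij.1 ij.2|) (i, j)).
Qed.

Lemma measurable_norm_gt d (T : measurableType d) m n (Z : T -> 'M[R]_(m, n)) (a : R) :
  0 <= a -> (forall i j, measurable_fun setT (fun w => Z w i j)) ->
  measurable [set w | a < `|Z w|].
Proof.
move=> a0 mZ.
have -> : [set w | a < `|Z w|] =
    \bigcup_(ij in [set: 'I_m * 'I_n]) [set w | a < `|Z w ij.1 ij.2|].
  apply/seteqP; split=> [w /(norm_gt_entry a0)[i [j aij]]|w [[i j] _] /= aij].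
    by exists (i, j).
  exact: lt_le_trans aij (norm_entry_le _ _ _).
apply: fin_bigcup_measurable; first exact: finite_finset.
by move=> ij _; apply: measurable_gt_cst; exact: measurableT_comp.
Qed.

Lemma oP1_of_bounds (d : nat -> measure_display) (T : forall n, measurableType (d n))
    (P : forall n, probability (T n) R) (r c : nat -> nat)
    (Z : forall n, T n -> 'M[R]_(r n, c n)) (b q : nat -> R) :
  (forall n i j, measurable_fun setT (fun w => Z n w i j)) ->
  b @ \oo --> 0 -> q @ \oo --> 0 ->
  (\forall n \near \oo, exists Bad : set (T n),
     [/\ measurable Bad, (P n Bad <= (q n)%:E)%E &
       forall w, ~ Bad w -> forall i j, `|Z n w i j| <= b n]) ->
  oP1 P Z.
Proof.
move=> mZ b0 q0 H e e0.
have be : \forall n \near \oo, b n <= e.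
  have /cvgrPdist_le/(_ e e0) := b0; apply: filterS => n.
  by rewrite sub0r normrN => /(le_trans (ler_norm _)).
have up : \forall n \near \oo, (0 <= P n [set w | (e < `|Z n w|)%R] <= (q n)%:E)%E.
  near=> n; rewrite measure_ge0/=.
  have [Bad [mB PB good]] : exists Bad : set (T n),
     [/\ measurable Bad, (P n Bad <= (q n)%:E)%E &
       forall w, ~ Bad w -> forall i j, `|Z n w i j| <= b n] by near: n.
  apply: le_trans PB; apply: le_measure; rewrite ?inE//.
    by apply: measurable_norm_gt => //; exact: ltW.
  move=> w /= eZ; apply: contrapT => /good small.
  have [i [j eij]] := norm_gt_entry (ltW e0) eZ.
  have bn : b n <= e by near: n.
  by have := le_lt_trans (le_trans (small i j) bn) eij; rewrite ltxx.
apply: (squeeze_cvge up); first exact: cvg_cst.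
by apply/cvg_EFin => //; exact: nearW.
Unshelve. all: by end_near. Qed.

End convergence_in_probability.

(** * Asymptotics *)

Section asymptotics.
Context {R : realType}.

(** [h] plays the part of [1 / g]: sparsity rates stated with little-o become limits of products
    with [log p / n]. *)
Lemma littleo1_mul_cvg0 (f g h : nat -> R) : f =o_\oo g ->
  (\forall n \near \oo, `|h n| * `|g n| <= 1) ->
  (fun n => h n * f n) @ \oo --> 0.
Proof.
move=> /eqoP fg hg; apply/cvgrPdist_le => e e0.
have {}fg := fg e e0.
near=> n; rewrite sub0r normrN normrM.
have f1 : `|f n| <= e * `|g n| by near: n.
have h1 : `|h n| * `|g n| <= 1 by near: n.
apply: (@le_trans _ _ (`|h n| * (e * `|g n|))); first exact: ler_wpM2l.
by rewrite mulrCA -[leRHS]mulr1 ler_pM2l.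
Unshelve. all: by end_near. Qed.

Lemma bigO1_bound (f : nat -> R) : f =O_\oo (fun=> 1 : R) ->
  exists2 c, 0 < c & \forall n \near \oo, f n <= c.
Proof.
move=> /eqO_exP[c c0 H]; exists c => //.
by apply: filterS H => n; rewrite normr1 mulr1; apply: le_trans; exact: ler_norm.
Qed.

Lemma cvg0_near_le (u : nat -> R) e : u @ \oo --> 0 -> 0 < e ->
  \forall n \near \oo, u n <= e.
Proof.
move=> /cvgrPdist_le u0 e0; apply: filterS (u0 e e0) => n.
by rewrite sub0r normrN => /(le_trans (ler_norm _)).
Qed.

Lemma cvg0_sqrt (u : nat -> R) : u @ \oo --> 0 -> (fun n => Num.sqrt (u n)) @ \oo --> 0.
Proof.
move=> u0; rewrite -[X in _ --> X](@sqrtr0 R).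
by apply: continuous_cvg => //; exact: sqrt_continuous.
Qed.

Lemma cvg_tau2_error (K : R) (om q2 : nat -> R) : om @ \oo --> 0 -> q2 @ \oo --> 0 ->
  (fun n => tau2_error K (om n) (q2 n)) @ \oo --> 0.
Proof.
move=> om0 q20; rewrite -[X in _ --> X]addr0 -{1}(mulr0 K); apply: cvgD.
  by apply: cvgM => //; exact: cvg_cst.
apply: cvg0_sqrt; rewrite -[X in _ --> X](mulr0 (2 * K)).
by apply: cvgM => //; exact: cvg_cst.
Qed.

Lemma cvg_Omega_error (K l : R) (om q2 : nat -> R) : om @ \oo --> 0 -> q2 @ \oo --> 0 ->
  (fun n => Omega_error K l (om n) (q2 n)) @ \oo --> 0.
Proof.
move=> om0 q20; have t0 := cvg_tau2_error K om0 q20.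
have li : (fun n => l^-1 + om n) @ \oo --> l^-1.
  by rewrite -[X in _ --> X]addr0; apply: cvgD => //; exact: cvg_cst.
have Te : (fun n => Theta_error K l (om n) (q2 n)) @ \oo --> 0.
  have -> : 0 = 8 * 0 / l ^+ 2 + 8 * (0 * 0) / l ^+ 2 * l^-1 :> R.
    by rewrite !mulr0 !mul0r addr0.
  apply: cvgD; first by apply: cvgM; [apply: cvgM => //|]; exact: cvg_cst.
  apply: cvgM => //; apply: cvgM; last exact: cvg_cst.
  by apply: cvgM; [exact: cvg_cst|exact: cvgM].
have -> : 0 = 0 + 2 * 0 + 0 :> R by rewrite mulr0 !addr0.
apply: cvgD => //; apply: cvgD => //; apply: cvgM; first exact: cvg_cst.
apply: cvg0_sqrt; rewrite -[X in _ --> X](mul0r l^-1); exact: cvgM.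
Qed.

(** The three probabilities of [good_event] for the final parameters, with [1 / p] replaced by
    [1 / n] to leave a function of [n] alone. *)
Definition failure_bound (n : nat) : R :=
  16 / n%:R + 2 * expR (- (n%:R / 128)) + expR (1 / 2) / n%:R.

Lemma cvg_failure_bound : failure_bound @ \oo --> 0.
Proof.
have inv0 : (fun n : nat => n%:R^-1 : R) @ \oo --> 0.
  by rewrite -(cvg_shiftS (fun n : nat => n%:R^-1 : R)); exact: cvg_harmonic.
have -> : 0 = 16 * 0 + 2 * 0 + expR (1 / 2) * 0 :> R by rewrite !mulr0 !addr0.
apply: cvgD; last by apply: cvgM => //; exact: cvg_cst.
apply: cvgD; first by apply: cvgM => //; exact: cvg_cst.
apply: cvgM; first exact: cvg_cst.
have ny : (fun n : nat => n%:R / 128 : R) @ \oo --> +oo.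
  apply/cvgryPge => a; apply: filterS (nbhs_infty_ger (a * 128)) => n.
  by rewrite ler_pdivlMr.
exact: (cvg_comp _ (fun x : R => expR (- x)) ny (@cvgr_expR R)).
Qed.

(** Applied to [x = log p / n]. As [x <= 1 / 1024], the number [y = (256 x)^-1] is at least 4, so
    its truncation satisfies [k - 1 > y - 2 >= y / 2]. *)
Lemma truncn_rate (x K : R) (k := Num.truncn (256 * x)^-1) :
  0 < x -> x <= 1 / 1024 -> 0 < K -> (1 < k)%N /\ 2 * K / (k%:R - 1) <= 1024 * K * x.
Proof.
move=> x0 x1 K0.
have c256 : 0 < 256 :> R by rewrite ltr0n.
have y0 : 0 < 256 * x := mulr_gt0 c256 x0.
have ky : (256 * x)^-1 < k%:R + 1 by rewrite natr1; exact: truncnS_gt.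
have y4 : 4 <= (256 * x)^-1 by rewrite -[leRHS]div1r (ler_pdivlMr _ _ y0); lra.
split; first by rewrite -(ltr_nat R); lra.
have -> : 1024 * K * x = 2 * K / ((256 * x)^-1 / 2) by field; rewrite gt_eqF.
have K2 : 0 < 2 * K by rewrite mulr_gt0.
by rewrite (ler_pM2l K2) lef_pV2 ?posrE; lra.
Qed.

(* With [delta = 7 r] each of the O(p^2) deviation events has probability at most
   2 p^-3, as 49 / 16 >= 3; the truncation makes [(2 p) ^ k <= expR (n / 128)]. *)
Lemma failure_probability_le (n p : nat) (A s K L r : R) :
  (0 < n)%N -> (n < p)%N -> 0 < s -> 0 < K -> 8 * (1 + s * K) <= A ->
  L = ln p%:R -> r ^+ 2 = L / n%:R ->
  16 * p%:R ^+ 2 * expR (- (n%:R * (7 * r) ^+ 2 / 16)) +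
  (2 * p%:R) ^+ Num.truncn (n%:R / (256 * L)) * (2 * expR (- (n%:R / 64))) +
  p%:R * expR (1 / 2 - (A * r / 2) ^+ 2 * n%:R / (4 * (s * (2 * K)))) <= failure_bound n.
Proof.
move=> n0 np s0 K0 AE LE r2.
have nn : 0 < n%:R :> R by rewrite ltr0n.
have pp : 0 < p%:R :> R by rewrite ltr0n (leq_trans _ np).
have p2 : 2 <= p%:R :> R by rewrite ler_nat (leq_trans _ np).
have L0 : 0 < L by rewrite LE; apply: ln_gt0; lra.
have eL : expR L = p%:R by rewrite LE lnK// posrE.
have pinv : p%:R^-1 <= n%:R^-1 :> R by rewrite lef_pV2 ?posrE// ler_nat ltnW.
rewrite /failure_bound; apply: lerD; first apply: lerD.
- apply: (@le_trans _ _ (16 * p%:R ^+ 2 * expR (- (3 * L)))).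
    rewrite ler_pM2l ?mulr_gt0 ?exprn_gt0// ler_expR lerN2 exprMn r2.
    have -> : n%:R * (7 ^+ 2 * (L / n%:R)) / 16 = 49 / 16 * L by field; rewrite gt_eqF.
    by lra.
  rewrite expRN expRM_natl eL.
  have -> : 16 * p%:R ^+ 2 * (p%:R ^+ 3)^-1 = 16 * p%:R^-1 :> R by field; rewrite gt_eqF.
  by rewrite ler_pM2l.
- rewrite mulrCA ler_pM2l//.
  apply: (@le_trans _ _ ((p%:R ^+ 2) ^+ Num.truncn (n%:R / (256 * L)) * expR (- (n%:R / 64)))).
    rewrite ler_pM2r ?expR_gt0//; apply: lerXn2r; rewrite ?nnegrE; last first.
    - by rewrite expr2 ler_pM2r.
    - by rewrite exprn_ge0// ltW.
    - by rewrite mulr_ge0// ltW.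
  rewrite -eL -!expRM_natl -expRD ler_expR.
  have c256 : 0 < 256 :> R by rewrite ltr0n.
  have x0 : 0 < 256 * L := mulr_gt0 c256 L0.
  have : (Num.truncn (n%:R / (256 * L)))%:R <= n%:R / (256 * L) :> R.
    by rewrite truncn_le; exact: (divr_ge0 (ler0n _ _) (ltW x0)).
  by rewrite (ler_pdivlMr _ _ x0); lra.
(* The choice of [A] gives [A^2 >= 64 s K], so each noise event costs at most
   [exp (1 / 2) / p^2]. *)
apply: (@le_trans _ _ (p%:R * expR (1 / 2 - 2 * L))).
  rewrite ler_pM2l// ler_expR lerD2l lerN2.
  have -> : (A * r / 2) ^+ 2 * n%:R / (4 * (s * (2 * K))) = A ^+ 2 / (32 * (s * K)) * L.
    by rewrite !exprMn r2; field; rewrite !gt_eqF.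
  rewrite ler_pM2r// ler_pdivlMr; last by rewrite !mulr_gt0.
  have sK : 0 < s * K by rewrite mulr_gt0.
  have : (8 * (1 + s * K)) ^+ 2 <= A ^+ 2 by rewrite ler_pXn2r ?nnegrE//; lra.
  have := sqr_ge0 (s * K); lra.
rewrite expRD expRN expRM_natl eL mulrCA ler_pM2l ?expR_gt0//.
by have -> : p%:R * (p%:R ^+ 2)^-1 = p%:R^-1 :> R by field; rewrite gt_eqF.
Qed.

End asymptotics.

(** * Measurability of the nodewise estimator *)

Section estimator_measurability.
Context {R : realType}.

(* The formula in the proof also holds at 0, where [0^-1 = 0]. *)
Lemma measurable_invr : measurable_fun setT (@GRing.inv R).
Proof.
rewrite (_ : GRing.inv = fun x : R => x * expR (- ln (x ^+ 2))); last first.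
  apply/funext => x; have [->|x0] := eqVneq x 0; first by rewrite invr0 mul0r.
  have x20 : 0 < x ^+ 2 by rewrite exprn_even_gt0.
  by rewrite expRN lnK ?posrE// expr2 invfM mulrA divff// mul1r.
apply: measurable_funM => //; apply: measurableT_comp => //.
apply: measurableT_comp => //; apply: measurableT_comp; first exact: measurable_ln.
exact: measurable_funX.
Qed.

Lemma measurable_Theta_lasso n p (lam : 'I_p -> R)
    (g : 'I_p -> {mfun borelM R n p >-> borelM R p.-1 1}) i j :
  measurable_fun setT (fun x : borelM R n p =>
    Theta_lasso lam (x : 'M[R]_(n, p)) (fun k => g k x : 'cV[R]_p.-1) i j).
Proof.
have mg k a b : measurable_fun setT (fun x : borelM R n p => (g k x : 'cV[R]_p.-1) a b).
  exact: measurable_entry.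
have mx a b : measurable_fun setT (fun x : borelM R n p => (x : 'M[R]_(n, p)) a b).
  exact: measurable_coord.
have -> : (fun x : borelM R n p =>
      Theta_lasso lam (x : 'M[R]_(n, p)) (fun k => g k x : 'cV[R]_p.-1) i j) =
    (fun x : borelM R n p =>
      (nodewise_tau2 (lam i) (x : 'M[R]_(n, p)) i (g i x : 'cV[R]_p.-1))^-1 *
       (if unlift i j is Some k then - (g i x : 'cV[R]_p.-1) k 0 else 1)).
  by apply/funext => x; rewrite /Theta_lasso mul_diag_mx !mxE.
apply: measurable_funM; last first.
  case: (unlift i j) => [k|]; last exact: measurable_cst.
  by apply: measurableT_comp => //; exact: measurable_oppr.
apply: (measurableT_comp measurable_invr); rewrite /nodewise_tau2.
apply: measurable_funD; apply: measurable_funM => //.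
  apply: measurable_sum => a; apply: measurable_funX.
  under eq_fun do rewrite mxE; apply: measurable_funD.
    by under eq_fun do rewrite mxE; exact: mx.
  under eq_fun do rewrite mxE; apply: measurableT_comp => //.
  apply: measurable_mulmx => b c //.
  by under eq_fun do rewrite mxE; exact: mx.
by apply: measurable_sum => a; apply: measurableT_comp.
Qed.

End estimator_measurability.

(** * Choice of the constants and passage to the limit *)

Theorem theorem2p2 (R : realType) (p : nat -> nat)
  (d : nat -> measure_display) (T : forall n, measurableType (d n))
  (P : forall n, probability (T n) R)
  (X : forall n, {RV (P n) >-> borelM R n (p n)})
  (eps : forall n, {RV (P n) >-> borelM R n 1})
  (beta0 : forall n, 'cV[R]_(p n)) (sigma_eps : nat -> R)
  (Y : forall n, T n -> 'cV[R]_n)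
  (Sigma : forall n, 'M[R]_(p n)) (Lambda2_min : nat -> R)
  (p_gt : forall n, (n < p n)%N)
  (log_p : (fun n => ln (p n)%:R / n%:R : R) =o_\oo (fun=> 1 : R))
  (model : forall n w, Y n w = (X n w : 'M[R]_(n, p n)) *m beta0 n + (eps n w : 'cV[R]_n))
  (eps_normal : forall n,
     mvnormal (distribution (P n) (eps n)) 0 ((sigma_eps n ^+ 2)%:M))
  (eps_indep : forall n, independent2 (P n) (eps n) (X n))
  (sigma_bounded : (fun n => sigma_eps n ^+ 2) =O_\oo (fun=> 1 : R))
  (X_rows : forall n, iid_gaussian_rows (X n))
  (Sigma_def : forall n, (0 < n)%N -> Sigma n = inner_product_matrix (P n) (X n))
  (Lambda_eig : forall n, smallest_eigenvalue (Sigma n) (Lambda2_min n))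
  (Lambda_gt0 : forall n, 0 < Lambda2_min n)
  (Lambda_bounded : (fun n => 1 / Lambda2_min n) =O_\oo (fun=> 1 : R))
  (Sigma_diag_bounded :
     (fun n => \big[Num.max/0]_(j < p n) Sigma n j j) =O_\oo (fun=> 1 : R))
  (s0_sparse : (fun n => (sparsity (beta0 n))%:R : R) =o_\oo
     (fun n => Num.sqrt n%:R / ln (p n)%:R : R))
  (sj_sparse :
     (fun n => (\max_(j < p n) row_sparsity (invmx (Sigma n)) j)%:R : R) =o_\oo
     (fun n => n%:R / ln (p n)%:R : R)) :
  exists (lam : nat -> R) (lamj : forall n, 'I_(p n) -> R),
    (exists c C : R, [/\ 0 < c, 0 < C,
       forall n, c * Num.sqrt (ln (p n)%:R / n%:R) <= lam n
                 <= C * Num.sqrt (ln (p n)%:R / n%:R) &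
       forall n j, c * Num.sqrt (ln (p n)%:R / n%:R) <= lamj n j
                 <= C * Num.sqrt (ln (p n)%:R / n%:R)]) /\
    forall
      (betahat : forall n,
         {mfun (borelM R n 1 * borelM R n (p n))%type >-> borelM R (p n) 1})
      (gammahat : forall n, 'I_(p n) ->
         {mfun borelM R n (p n) >-> borelM R (p n).-1 1}),
      (forall n y x, is_lasso (lam n) (y : 'cV[R]_n) x (betahat n (y, x))) ->
      (forall n j x, is_nodewise_lasso (lamj n j) x j (gammahat n j x)) ->
      let Theta n (x : 'M[R]_(n, p n)) :=
        Theta_lasso (lamj n) x (fun j => gammahat n j x) in
      let Omega n (x : 'M[R]_(n, p n)) := Omega_hat (Theta n x) x in
      let bhat n w :=
        desparsified (Theta n (X n w)) (Y n w) (X n w)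
                     (betahat n (Y n w, X n w)) in
      (exists W Delta : forall n, {RV (P n) >-> borelM R (p n) 1},
        [/\ forall n w, Num.sqrt n%:R *: (bhat n w - beta0 n) =
                        (W n w : 'cV[R]_(p n)) + Delta n w,
            forall n, cond_centered_normal (W n) (X n)
                        (fun x => sigma_eps n ^+ 2 *: Omega n x) &
            oP1 P (fun n w => Delta n w : 'cV[R]_(p n))]) /\
      oP1 P (fun n w => Omega n (X n w) - invmx (Sigma n)).
Proof.
have [s s0 sE] := bigO1_bound sigma_bounded.
have [M M0 ME] := bigO1_bound Lambda_bounded.
have [K K0 KE] := bigO1_bound Sigma_diag_bounded.
(* For large [n] a lower bound of the smallest eigenvalue. *)
pose l := M^-1; have l0 : 0 < l by rewrite invr_gt0.
(* The first term of [A] puts the nodewise noise below half of the penalty, the second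
   one the noise of the lasso. *)
pose A := 14 * K * (K + l^-1) + 8 * (1 + s * K).
have KK : 0 < K * (K + l^-1) by rewrite mulr_gt0// addr_gt0// invr_gt0.
have sK : 0 < s * K by rewrite mulr_gt0.
have A0 : 0 < A by rewrite /A; lra.
pose r2 n : R := ln (p n)%:R / n%:R; pose r n := Num.sqrt (r2 n).
exists (fun n => A * r n), (fun n _ => A * r n); split.
  by exists A, A; split => // n; rewrite lexx.
move=> betahat gammahat Hb Hg Theta Omega bhat.
pose smax n : R := (\max_(j < p n) row_sparsity (invmx (Sigma n)) j)%:R.
pose sp0 n : R := (sparsity (beta0 n))%:R.
have ln_gt n : (0 < n)%N -> 0 < ln (p n)%:R :> R.
  by move=> n0; apply: ln_gt0; rewrite ltr1n (leq_ltn_trans _ (p_gt n)).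
have r2_ge0 n : 0 <= r2 n.
  rewrite /r2 divr_ge0// ln_ge0// ler1n (leq_trans _ (p_gt n))//.
have rE n : r n ^+ 2 = r2 n by rewrite sqr_sqrtr.
have r2_cvg : r2 @ \oo --> 0.
  rewrite (_ : r2 = fun n => 1 * (ln (p n)%:R / n%:R)).
    by apply: (littleo1_mul_cvg0 log_p); apply: nearW => n; rewrite normr1 mulr1.
  by apply/funext => n; rewrite mul1r.
have r_cvg : r @ \oo --> 0 by exact: cvg0_sqrt.
have smax_cvg : (fun n => r2 n * smax n) @ \oo --> 0.
  apply: (littleo1_mul_cvg0 sj_sparse); apply: filterS (nbhs_infty_gt 0) => n n0.
  rewrite -normrM /r2 mulrA divfK ?gt_eqF ?ltr0n// divff ?normr1//.
  by rewrite gt_eqF// ln_gt.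
have sp0_cvg : (fun n => r2 n * Num.sqrt n%:R * sp0 n) @ \oo --> 0.
  apply: (littleo1_mul_cvg0 s0_sparse); apply: filterS (nbhs_infty_gt 0) => n n0.
  have nn : 0 < n%:R :> R by rewrite ltr0n.
  have e : r2 n * Num.sqrt n%:R * (Num.sqrt n%:R / ln (p n)%:R) = 1.
    have -> : r2 n * Num.sqrt n%:R * (Num.sqrt n%:R / ln (p n)%:R) =
       r2 n * Num.sqrt n%:R ^+ 2 / ln (p n)%:R by ring.
    rewrite sqr_sqrtr ?ltW// /r2 divfK ?gt_eqF// divff// gt_eqF//; exact: ln_gt.
  by rewrite -normrM e normr1.
(* The level of [good_event] at [delta = 7 * r n]. *)
pose om n := 7 * r n * (K + l^-1).
have om_cvg : om @ \oo --> 0.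
  have -> : 0 = 7 * 0 * (K + l^-1) :> R by rewrite mulr0 mul0r.
  by apply: cvgM; [apply: cvgM => //|]; exact: cvg_cst.
pose q2 n := 64 * (A * r n) ^+ 2 * smax n / l.
have q2_cvg : q2 @ \oo --> 0.
  have -> : q2 = fun n => 64 * A ^+ 2 / l * (r2 n * smax n).
    by apply/funext => n; rewrite /q2 exprMn rE; field; rewrite gt_eqF.
  by rewrite -[X in _ --> X](mulr0 (64 * A ^+ 2 / l)); apply: cvgM => //; exact: cvg_cst.
(* The l1 penalty that [truncn_rate] provides at [x = r2 n]. *)
pose rho n := 1024 * K * r2 n.
pose bD n := 32 * (A * r n) ^+ 2 / l ^+ 2 * (Num.sqrt n%:R * sp0 n).
have bD_cvg : bD @ \oo --> 0.
  have -> : bD = fun n => 32 * A ^+ 2 / l ^+ 2 * (r2 n * Num.sqrt n%:R * sp0 n).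
    by apply/funext => n; rewrite /bD exprMn rE; field; rewrite gt_eqF.
  by rewrite -[X in _ --> X](mulr0 (32 * A ^+ 2 / l ^+ 2)); apply: cvgM => //; exact: cvg_cst.
pose bO n := Omega_error K l (om n) (q2 n).
have bO_cvg : bO @ \oo --> 0 by exact: cvg_Omega_error.
pose Th n w : 'M[R]_(p n) := Theta n (X n w).
pose Wf n w : borelM R (p n) 1 := Num.sqrt n%:R *:
  (n%:R^-1 *: (Th n w *m (X n w : 'M[R]_(n, p n))^T *m (eps n w : 'cV[R]_n))).
(* Taken as the difference, so that the decomposition is exact for every [n] and [w]; the estimates
   concern large [n]. *)
pose Df n w : borelM R (p n) 1 := Num.sqrt n%:R *: (bhat n w - beta0 n) - Wf n w.
have key : \forall n \near \oo, exists Bad : set (T n),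
   [/\ measurable Bad, (P n Bad <= (@failure_bound R n)%:E)%E,
     forall w, ~ Bad w -> forall j, `|(Df n w : 'cV[R]_(p n)) j 0| <= bD n &
     forall w, ~ Bad w -> forall i j,
       `|(Omega n (X n w) - invmx (Sigma n)) i j| <= bO n].
  have e1 : 0 < 2 / 7 :> R by lra.
  have e3 : 0 < 1 / 1024 :> R by lra.
  have h1 := cvg0_near_le r_cvg e1.
  have h2 := cvg0_near_le om_cvg K0.
  have h3 := cvg0_near_le r2_cvg e3.
  have c4 : (fun n => 16 * 1024 * K * (r2 n * smax n)) @ \oo --> 0.
    rewrite -[X in _ --> X](mulr0 (16 * 1024 * K)).
    by apply: cvgM => //; exact: cvg_cst.
  have l4 : 0 < l / 4 by rewrite divr_gt0.
  have h4 := cvg0_near_le c4 l4.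
  have c5 : (fun n => 16 * 1024 * K * (r2 n * Num.sqrt n%:R * sp0 n)) @ \oo --> 0.
    rewrite -[X in _ --> X](mulr0 (16 * 1024 * K)).
    by apply: cvgM => //; exact: cvg_cst.
  have h5 := cvg0_near_le c5 l4.
  have c6 := cvg_tau2_error K om_cvg q2_cvg.
  have l2 : 0 < l / 2 by rewrite divr_gt0.
  have h6 := cvg0_near_le c6 l2.
  near=> n.
  have n0 : (0 < n)%N by near: n; exact: nbhs_infty_gt.
  have nn : 0 < n%:R :> R by rewrite ltr0n.
  have n1 : 1 <= n%:R :> R by rewrite ler1n.
  have Ln := ln_gt n n0.
  have r20 : 0 < r2 n by rewrite divr_gt0.
  have r0 : 0 < r n by rewrite sqrtr_gt0.
  have sn : sigma_eps n ^+ 2 <= s by near: n; exact: sE.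
  have Mn : 1 / Lambda2_min n <= M by near: n; exact: ME.
  have Kn : \big[Num.max/0]_(j < p n) Sigma n j j <= K by near: n; exact: KE.
  have rn : r n <= 2 / 7 by near: n; exact: h1.
  have omn : om n <= K by near: n; exact: h2.
  have r2n : r2 n <= 1 / 1024 by near: n; exact: h3.
  have smn : 16 * 1024 * K * (r2 n * smax n) <= l / 4 by near: n; exact: h4.
  have spn : 16 * 1024 * K * (r2 n * Num.sqrt n%:R * sp0 n) <= l / 4 by near: n; exact: h5.
  have tn : tau2_error K (om n) (q2 n) <= l / 2 by near: n; exact: h6.
  have SE := Sigma_def n n0.
  have sS : (Sigma n)^T = Sigma n by exact: inner_product_matrix_sym SE.
  have Sl u : l * sqnorm2 u <= qform (Sigma n) u.
    apply: le_trans (smallest_eigenvalue_le u sS (Lambda_eig n)).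
    rewrite ler_wpM2r ?sqnorm2_ge0// /l -[leRHS]invrK lef_pV2 ?posrE ?invr_gt0//.
    by rewrite -[leLHS]mul1r.
  have SK j : Sigma n j j <= K by apply: le_trans Kn; exact: (le_bigmax _ (fun j => Sigma n j j)).
  pose k := Num.truncn (n%:R / (256 * ln (p n)%:R) : R).
  have xE : n%:R / (256 * ln (p n)%:R) = (256 * r2 n)^-1 :> R.
    by rewrite /r2; field; rewrite !gt_eqF.
  have [k1 rhoE] : (1 < k)%N /\ 2 * K / (k%:R - 1) <= rho n.
    by rewrite /k xE; exact: truncn_rate.
  have sm j : (row_sparsity (invmx (Sigma n)) j)%:R <= smax n.
    by rewrite /smax ler_nat; exact: (leq_bigmax j).
  have la0 : 0 < A * r n by rewrite mulr_gt0.
  have laE : 2 * K * om n <= A * r n.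
    have -> : 2 * K * om n = 14 * K * (K + l^-1) * r n by rewrite /om; ring.
    by rewrite ler_pM2r// /A lerDl mulr_ge0// addr_ge0// ltW.
  have rho0 : 0 <= rho n by exact: (mulr_ge0 (mulr_ge0 (ler0n _ 1024) (ltW K0)) (r2_ge0 n)).
  have d0 : 0 < 7 * r n by rewrite mulr_gt0.
  have d2 : 7 * r n <= 2 by rewrite mulrC -ler_pdivlMr.
  have rs1 : 16 * rho n * smax n <= l / 4.
    by apply: le_trans smn; rewrite le_eqVlt; apply/orP; left; apply/eqP; rewrite /rho; ring.
  (* The sparsity assumption on [beta0] controls [r2 n * sqrt n * sp0 n], which dominates
     [r2 n * sp0 n] because [1 <= sqrt n]. *)
  have rs2 : 16 * rho n * sp0 n <= l / 4.
    apply: le_trans spn.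
    have -> : 16 * rho n * sp0 n = 16 * 1024 * K * (r2 n * 1 * sp0 n) by rewrite /rho; ring.
    have e16 : 0 < 16 :> R by rewrite ltr0n.
    have e1024 : 0 < 1024 :> R by rewrite ltr0n.
    have c0 : 0 < 16 * 1024 * K by exact: (mulr_gt0 (mulr_gt0 e16 e1024) K0).
    rewrite ler_pM2l// ler_wpM2r// ler_pM2l//.
    by rewrite -[leLHS]sqrtr1 ler_wsqrtr.
  have Hb' w : is_lasso (A * r n) ((X n w : 'M[R]_(n, p n)) *m beta0 n + (eps n w : 'cV[R]_n))
      (X n w : 'M[R]_(n, p n)) (betahat n (Y n w, X n w) : 'cV[R]_(p n)).
    by rewrite -model; exact: Hb.
  have [Bad [mB PB DB OB]] := @fixed_sample_bounds R (d n) (T n) (P n) n (p n) (X n) (eps n)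
    (sigma_eps n ^+ 2) (beta0 n) (Sigma n) l K s (7 * r n) (A * r n) (rho n) (smax n) k
    (fun w => betahat n (Y n w, X n w)) (fun w j => gammahat n j (X n w)) (fun=> A * r n)
    (eps_indep n) (eps_normal n) (X_rows n) n0 SE l0 Sl K0 SK s0 sn d0 d2 k1
    la0 laE omn rho0 rhoE (fun=> erefl) Hb' (fun w j => Hg n j (X n w)) sm rs1 rs2 tn.
  exists Bad; split => //.
    apply: (le_trans PB); rewrite lee_fin.
    have AE : 8 * (1 + s * K) <= A by rewrite /A lerDr -mulrA mulr_ge0// ltW.
    exact: (failure_probability_le n0 (p_gt n) s0 K0 AE erefl (rE n)).
  by move=> w nB j; have := DB w nB j; rewrite -model.
have mX n i j : measurable_fun setT (fun w => (X n w : 'M[R]_(n, p n)) i j).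
  exact: measurable_entry.
have mTx n i j : measurable_fun setT (fun x : borelM R n (p n) => Theta n (x : 'M[R]_(n, p n)) i j).
  exact: measurable_Theta_lasso.
have mTh n i j : measurable_fun setT (fun w => Th n w i j).
  exact: (measurableT_comp (mTx n i j) (measurable_funPT (X n))).
have mW n : measurable_fun setT (Wf n).
  apply: measurable_borelM => i j; rewrite /Wf.
  under eq_fun do rewrite mxE; apply: measurable_funM => //.
  under eq_fun do rewrite mxE; apply: measurable_funM => //.
  apply: measurable_mulmx => a b; last exact: measurable_entry.
  apply: measurable_mulmx => // a' b'.
  by under eq_fun do rewrite mxE; exact: mX.
have mY n : measurable_fun setT (Y n : T n -> borelM R n 1).
  apply: measurable_borelM => i j; rewrite (_ : (fun w => _) = fun w =>
     ((X n w : 'M[R]_(n, p n)) *m beta0 n) i j + (eps n w : 'cV[R]_n) i j); last first.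
    by apply/funext => w; rewrite model mxE.
  apply: measurable_funD; last exact: measurable_entry.
  by apply: measurable_mulmx => // a b; exact: measurable_cst.
have mbeta n i j : measurable_fun setT (fun w => (betahat n (Y n w, X n w) : 'cV[R]_(p n)) i j).
  apply: (measurable_entry (f := fun w => betahat n (Y n w, X n w))).
  exact: (measurableT_comp (measurable_funPT (betahat n))
    (measurable_fun_pair (mY n) (measurable_funPT (X n)))).
have mbhat n i j : measurable_fun setT (fun w => bhat n w i j).
  rewrite /bhat /desparsified; under eq_fun do rewrite mxE.
  apply: measurable_funD => //; under eq_fun do rewrite mxE; apply: measurable_funM => //.
  apply: measurable_mulmx => a b.
    apply: measurable_mulmx => a' b'; first exact: mTh.
    by under eq_fun do rewrite mxE; exact: mX.
  under eq_fun do rewrite mxE; apply: measurable_funD.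
    exact: measurable_entry.
  under eq_fun do rewrite mxE; apply: measurableT_comp => //.
  exact: measurable_mulmx.
have mD n : measurable_fun setT (Df n).
  apply: measurable_borelM => i j; rewrite /Df.
  under eq_fun do rewrite mxE; apply: measurable_funD.
    under eq_fun do rewrite mxE; apply: measurable_funM => //.
    under eq_fun do rewrite mxE; apply: measurable_funD => //; exact: measurable_cst.
  under eq_fun do rewrite mxE; apply: measurableT_comp => //.
  exact: measurable_entry.
pose W n : {RV (P n) >-> borelM R (p n) 1} :=
  HB.pack (Wf n) (isMeasurableFun.Build _ _ _ _ _ (mW n)).
pose Delta n : {RV (P n) >-> borelM R (p n) 1} :=
  HB.pack (Df n) (isMeasurableFun.Build _ _ _ _ _ (mD n)).
split; last first.
  apply: (oP1_of_bounds _ bO_cvg (@cvg_failure_bound R)).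
    move=> n i j; under eq_fun do rewrite mxE; apply: measurable_funD; last exact: measurable_cst.
    rewrite /Omega /Omega_hat; apply: measurable_mulmx => a b.
      apply: measurable_mulmx => a' b'; first exact: mTh.
      rewrite /gram; under eq_fun do rewrite mxE; apply: measurable_funM => //.
      apply: measurable_mulmx => a'' b'' //.
      by under eq_fun do rewrite mxE; exact: mX.
    by under eq_fun do rewrite mxE; exact: mTh.
  by apply: filterS key => n [Bad [mB PB _ HO]]; exists Bad.
exists W, Delta; split.
- by move=> n w; rewrite /Delta /W /= /Df [RHS]addrC subrK.
- move=> n.
  apply: (cond_centered_normal_linear (eps_indep n) (eps_normal n)
    (B := fun x => Num.sqrt n%:R *: (n%:R^-1 *: (Theta n x *m x^T)))).
  + move=> i j; under eq_fun do rewrite mxE; apply: measurable_funM => //.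
    under eq_fun do rewrite mxE; apply: measurable_funM => //.
    apply: measurable_mulmx => a b; first exact: mTx.
    by under eq_fun do rewrite mxE; exact: measurable_coord.
  + by move=> w; rewrite /W /= /Wf -!scalemxAl.
  move=> x; congr (_ *: _); rewrite /Omega /Omega_hat /gram.
  have -> : (Num.sqrt n%:R *: (n%:R^-1 *: (Theta n x *m x^T)))^T =
      Num.sqrt n%:R *: (n%:R^-1 *: (x *m (Theta n x)^T)).
    by rewrite linearZ/= linearZ/= trmx_mul trmxK.
  rewrite -!scalemxAl -!scalemxAr -!scalemxAl !scalerA !mulmxA.
  (* The conditional law is claimed for every [n]; at [n = 0] both factors vanish since
     [0^-1 = 0]. *)
  congr (_ *: _); have [->|n0] := posnP n; first by rewrite invr0 !(mulr0, mul0r).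
  have nn : 0 < n%:R :> R by rewrite ltr0n.
  transitivity (Num.sqrt n%:R ^+ 2 / n%:R ^+ 2 : R); last by field; rewrite gt_eqF.
  by rewrite sqr_sqrtr ?ltW//; field; rewrite gt_eqF.
apply: (oP1_of_bounds _ bD_cvg (@cvg_failure_bound R)).
  by move=> n i j; exact: measurable_entry.
apply: filterS key => n [Bad [mB PB HD _]]; exists Bad; split => // w nB i j.
by rewrite (ord1 j); exact: HD.
Unshelve. all: by end_near. Qed.
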